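(* Let $k\ge1$ be an integer. (1) For every $t\ge0$ one can define a map $\mathbb{B}_t:\mathcal{D}_c(k)\to\mathcal{D}_c(k)$ by $\mathbb{B}_t(\mu)=\bigl(\mu^{\boxplus(1+t)}\bigr)^{\uplus(1/(1+t))}$, $\mu\in\mathcal{D}_c(k)$; that is, the right-hand side belongs to $\mathcal{D}_c(k)$ whenever $\mu\in\mathcal{D}_c(k)$. (2) These transformations of $\mathcal{D}_c(k)$ form a semigroup: $\mathbb{B}_s\circ\mathbb{B}_t=\mathbb{B}_{s+t}$ for all $s,t\ge0$. (3) For $t=1$ we have $\mathbb{B}_1(\mu)=\mathbb{B}(\mu)$ for all $\mu\in\mathcal{D}_c(k)$, where $\mathbb{B}$ is the multi-variable Boolean Bercovici-Pata bijection, determined by $R_{\mathbb{B}(\mu)}=\eta_\mu$.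
   Context: Let $\mathbb{C}\langle X_1,\ldots,X_k\rangle$ be the algebra of non-commutative polynomials, and let $\mathcal{D}_{\mathrm{alg}}(k)$ be the set of linear functionals $\mu:\mathbb{C}\langle X_1,\ldots,X_k\rangle\to\mathbb{C}$ with $\mu(1)=1$. For elements $x_1,\ldots,x_k$ of a non-commutative probability space $(\mathcal{A},\varphi)$ (unital complex algebra with a linear functional, $\varphi(1)=1$), their joint distribution is the $\mu\in\mathcal{D}_{\mathrm{alg}}(k)$ with $\mu(X_{i_1}\cdots X_{i_n})=\varphi(x_{i_1}\cdots x_{i_n})$. $\mathcal{D}_c(k)\subseteq\mathcal{D}_{\mathrm{alg}}(k)$ is the set of joint distributions of $k$-tuples of selfadjoint elements in $C^*$-probability spaces (unital $C^*$-algebra $\mathcal{A}$ with a positive linear functional $\varphi$, $\varphi(1)=1$). Let $\mathbb{C}_0\langle\langle z_1,\ldots,z_k\rangle\rangle$ be the space of formal power series with zero constant term in non-commuting indeterminates $z_1,\ldots,z_k$. For $\mu\in\mathcal{D}_{\mathrm{alg}}(k)$: - the moment series is $M_\mu=\sum_{n\ge1}\sum_{i_1,\ldots,i_n=1}^k\mu(X_{i_1}\cdots X_{i_n})z_{i_1}\cdots z_{i_n}$; - the $\eta$-series is $\eta_\mu=M_\mu(1+M_\mu)^{-1}$; - the $R$-transform $R_\mu\in\mathbb{C}_0\langle\langle z_1,\ldots,z_k\rangle\rangle$ is the unique series with $R_\mu\bigl(z_1(1+M_\mu),\ldots,z_k(1+M_\mu)\bigr)=M_\mu$. Both $\mu\mapsto\eta_\mu$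 and $\mu\mapsto R_\mu$ are bijections from $\mathcal{D}_{\mathrm{alg}}(k)$ onto $\mathbb{C}_0\langle\langle z_1,\ldots,z_k\rangle\rangle$. For $t>0$, $\mu^{\boxplus t}$ is the unique element of $\mathcal{D}_{\mathrm{alg}}(k)$ with $R_{\mu^{\boxplus t}}=tR_\mu$, and $\mu^{\uplus t}$ is the unique element with $\eta_{\mu^{\uplus t}}=t\eta_\mu$. *)

(* Defs.v *)
From HB Require Import structures.
From mathcomp Require Import all_boot all_order all_algebra.
From mathcomp Require Import all_classical all_reals.
From mathcomp Require Import complex.
(* the notations of monalg clash with those of mathcomp-classical *)
From mathcomp Require Import -(notations) monalg.

Set Implicit Arguments.
Unset Strict Implicit.
Unset Printing Implicit Defensive.

Import Order.TTheory GRing.Theory Num.Theory.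
Local Open Scope classical_set_scope.
Local Open Scope ring_scope.

(* [f w] is the coefficient of z_{i_1} ... z_{i_n} for [w = [:: i_1; ...; i_n]];
   the alias carries the Cauchy product, not the pointwise product of
   functions. *)
Definition ncseries (K : Type) (k : nat) : Type := seq 'I_k -> K.

Section NCSeries.
Variables (K : comNzRingType) (k : nat).
Local Notation series := (ncseries K k).
Implicit Types (f g h : series) (w : seq 'I_k).

HB.instance Definition _ :=
  GRing.Lmodule.copy series (seq 'I_k -> (K^o : lmodType K)).

Lemma ncaddE f g w : (f + g) w = f w + g w. Proof. by []. Qed.
Lemma ncoppE f w : (- f) w = - f w. Proof. by []. Qed.
Lemma nczeroE w : (0 : series) w = 0. Proof. by []. Qed.
Lemma ncscaleE (a : K) f w : (a *: f) w = a * f w. Proof. by []. Qed.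

Definition ncmul f g : series :=
  fun w => \sum_(i < (size w).+1) f (take i w) * g (drop i w).

Definition ncone : series := fun w => (w == [::])%:R.

Definition nctail f (a : 'I_k) : series := fun w => f (a :: w).

Lemma ncmul_nil f g : ncmul f g [::] = f [::] * g [::].
Proof. by rewrite /ncmul big_ord_recl big_ord0 addr0. Qed.

Lemma ncmul_cons f g a w :
  ncmul f g (a :: w) = f [::] * g (a :: w) + ncmul (nctail f a) g w.
Proof. by rewrite /ncmul big_ord_recl. Qed.

Lemma ncmulDl : left_distributive ncmul +%R.
Proof.
move=> f g h; apply: funext => w; rewrite ncaddE /ncmul -big_split /=.
by apply: eq_bigr => i _; rewrite ncaddE mulrDl.
Qed.

Lemma ncmulDr : right_distributive ncmul +%R.
Proof.
move=> f g h; apply: funext => w; rewrite ncaddE /ncmul -big_split /=.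
by apply: eq_bigr => i _; rewrite ncaddE mulrDr.
Qed.

Lemma ncmulZl (a : K) f g w : ncmul (a *: f) g w = a * ncmul f g w.
Proof.
by rewrite /ncmul mulr_sumr; apply: eq_bigr => i _; rewrite ncscaleE mulrA.
Qed.

Lemma ncmulA : associative ncmul.
Proof.
move=> f g h; apply: funext => w; elim: w f g h => [|a w IH] f g h.
  by rewrite !ncmul_nil mulrA.
rewrite !ncmul_cons IH ncmul_nil.
have -> : nctail (ncmul f g) a = f [::] *: nctail g a + ncmul (nctail f a) g.
  by apply: funext => u; rewrite /nctail ncmul_cons.
by rewrite ncmulDl ncaddE ncmulZl mulrDr mulrA addrA.
Qed.

Lemma ncmul1f : left_id ncone ncmul.
Proof.
move=> f; apply: funext => w; rewrite /ncmul big_ord_recl take0 drop0 /ncone.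
rewrite eqxx mul1r big1 ?addr0 // => i _.
by case: w i => [[]|a w i] //=; rewrite mul0r.
Qed.

Lemma ncmulf1 : right_id ncone ncmul.
Proof.
move=> f; apply: funext => w; rewrite /ncmul big_ord_recr /= drop_size take_size.
rewrite /ncone eqxx mulr1 big1 ?add0r // => i _.
by rewrite -size_eq0 size_drop subn_eq0 leqNgt ltn_ord mulr0.
Qed.

Lemma ncone_neq0 : ncone != 0.
Proof.
apply/eqP => /(congr1 (fun f : series => f [::])) /eqP.
by rewrite /ncone eqxx oner_eq0.
Qed.

HB.instance Definition _ := GRing.Zmodule_isNzRing.Build series
  ncmulA ncmul1f ncmulf1 ncmulDl ncmulDr ncone_neq0.

Definition ncunit : {pred series} :=
  fun f => `[< exists g, g * f = 1 /\ f * g = 1 >].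

Definition ncinv f : series :=
  if f \in ncunit then xget 0 [set g | g * f = 1 /\ f * g = 1] else f.

Lemma ncinvP f : f \in ncunit -> ncinv f * f = 1 /\ f * ncinv f = 1.
Proof.
move=> fu; rewrite /ncinv fu; case: xgetP => [_ -> //|].
by have /asboolP[g fg] := fu => /(_ g) /(_ fg).
Qed.

Lemma ncmulVr : {in ncunit, left_inverse 1 ncinv *%R}.
Proof. by move=> f /ncinvP[]. Qed.

Lemma ncmulrV : {in ncunit, right_inverse 1 ncinv *%R}.
Proof. by move=> f /ncinvP[]. Qed.

Lemma ncunitP f g : g * f = 1 /\ f * g = 1 -> f \in ncunit.
Proof. by move=> fg; apply/asboolP; exists g. Qed.

Lemma ncinv_out : {in [predC ncunit], ncinv =1 id}.
Proof. by move=> f /negPf fu; rewrite /ncinv fu. Qed.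

HB.instance Definition _ := GRing.NzRing_hasMulInverse.Build series
  ncmulVr ncmulrV ncunitP ncinv_out.

Lemma ncmulE f g w :
  (f * g) w = \sum_(i < (size w).+1) f (take i w) * g (drop i w).
Proof. by []. Qed.

Lemma nconeE w : (1 : series) w = (w == [::])%:R. Proof. by []. Qed.

Lemma ncsumE (I : Type) (r : seq I) (P : pred I) (F : I -> series) w :
  (\sum_(i <- r | P i) F i) w = \sum_(i <- r | P i) F i w.
Proof. by elim/big_rec2: _ => // i x y _ <-. Qed.

Lemma ncprod_size (I : Type) (r : seq I) (F : I -> series) w :
  (forall i, F i [::] = 0) -> (size w < size r)%N -> (\prod_(i <- r) F i) w = 0.
Proof.
move=> F0; elim: r w => [|j r IH] w //= wr; rewrite big_cons ncmulE big1 // => i _.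
have [->|i0] := eqVneq (i : nat) 0%N; first by rewrite take0 F0 mul0r.
case: w i wr i0 => [|a w] i /=; first by case: i => -[].
move=> wr i0; rewrite IH ?mulr0 // size_drop /=.
by case: (nat_of_ord i) i0 => // n _; rewrite subSS (leq_ltn_trans (leq_subr _ _)).
Qed.

(* A series with constant term 1 is invertible, so that [^-1] is a genuine
   inverse wherever it is used below. *)
Lemma ncunit_const1 f : f [::] = 1 -> f \is a GRing.unit.
Proof.
move=> f1; pose h : series := 1 - f.
have h0 : h [::] = 0 by rewrite /h ncaddE ncoppE f1 nconeE subrr.
have hX n w : (size w < n)%N -> (h ^+ n) w = 0.
  move=> wn; rewrite -(size_iota 0 n) in wn.
  have := @ncprod_size _ _ (fun=> h) w (fun=> h0) wn.
  by rewrite big_const_seq count_predT size_iota iter_mulr_1.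
pose g : series := fun w => \sum_(n < (size w).+1) (h ^+ n) w.
have gE w m : (size w <= m)%N -> g w = \sum_(n < m.+1) (h ^+ n) w.
  move=> wm; rewrite /g (big_ord_widen m.+1 (fun n => (h ^+ n) w)) //.
  rewrite big_mkcond; apply: eq_bigr => i _; case: ltnP => // wi.
  by rewrite hX.
have gS w : g w = (1 : series) w + \sum_(n < (size w).+1) (h ^+ n.+1) w.
  by rewrite (gE w (size w).+1) // big_ord_recl expr0.
have hg w : (h * g) w = \sum_(n < (size w).+1) (h ^+ n.+1) w.
  under eq_bigr do rewrite exprS.
  under [RHS]eq_bigr do rewrite ncmulE.
  rewrite ncmulE exchange_big; apply: eq_bigr => i _ /=.
  by rewrite (gE _ (size w)) ?size_drop ?leq_subr // mulr_sumr.
have gh w : (g * h) w = \sum_(n < (size w).+1) (h ^+ n.+1) w.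
  under [RHS]eq_bigr do rewrite exprSr.
  under [RHS]eq_bigr do rewrite ncmulE.
  rewrite ncmulE exchange_big; apply: eq_bigr => i _ /=.
  by rewrite (gE _ (size w)) ?size_take_min ?geq_minr // mulr_suml.
have fE : f = 1 - h by rewrite /h opprB addrC subrK.
apply: (@ncunitP f g); rewrite fE mulrBr mulrBl mul1r mulr1.
by split; apply: funext => w; rewrite ncaddE ncoppE gS ?hg ?gh addrK.
Qed.

Definition ncvar (i : 'I_k) : series := fun w => (w == [:: i])%:R.

(* Substitution f(g_1, ..., g_k), meant for g_i without constant term: the
   product of n such series has no coefficient on words shorter than n
   ([ncprod_size]), so the infinite sum over all monomials of [f] reduces,
   at each [w], to those of degree at most [size w]. *)
Definition ncsubst f (g : 'I_k -> series) : series := fun w =>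
  \sum_(n < (size w).+1) \sum_(u : n.-tuple 'I_k)
     f u * (\prod_(i <- u) g i) w.

End NCSeries.

(* The hierarchies of algebras and of normed modules cannot be joined in the
   library, so the norm and its completeness are part of the mixin. *)
HB.mixin Record Algebra_isCstarAlgebra (R : realType) A
    of GRing.Algebra R[i] A := {
  star : A -> A;
  cnorm : A -> R;
  starD : forall x y : A, star (x + y) = star x + star y;
  starZ : forall (a : R[i]) (x : A), star (a *: x) = a^*%C *: star x;
  starM : forall x y : A, star (x * y) = star y * star x;
  starK : forall x : A, star (star x) = x;
  cnorm_eq0 : forall x : A, cnorm x = 0 -> x = 0;
  cnormD : forall x y : A, cnorm (x + y) <= cnorm x + cnorm y;
  cnormZ : forall (a : R[i]) (x : A),
    cnorm (a *: x) = Normc.normc a * cnorm x;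
  cnormM : forall x y : A, cnorm (x * y) <= cnorm x * cnorm y;
  cnorm_star : forall x : A, cnorm (star x * x) = cnorm x ^+ 2;
  cnorm_complete : forall u : nat -> A,
    (forall e : R, 0 < e -> exists N : nat, forall m n : nat,
       (N <= m)%N -> (N <= n)%N -> cnorm (u m - u n) < e) ->
    exists l : A, forall e : R, 0 < e -> exists N : nat, forall n : nat,
       (N <= n)%N -> cnorm (u n - l) < e
}.

#[short(type="cstarAlgType")]
HB.structure Definition CstarAlgebra (R : realType) :=
  {A of GRing.Algebra R[i] A & Algebra_isCstarAlgebra R A}.

Section Distributions.
Variables (R : realType) (k : nat).
Local Notation C := R[i].
Local Notation series := (ncseries C k).

(* C<X_1, ..., X_k> as the monoid algebra of the free monoid of words *)
Definition ncpoly : lalgType C := malg (fmonom 'I_k) C.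

Definition ncX (i : 'I_k) : ncpoly := mkmalgU (fmu i) 1.

Record dalg : Type := Dalg {
  dalg_fun :> {scalar ncpoly};
  dalg1 : dalg_fun 1 = 1
}.

HB.instance Definition _ := gen_eqMixin dalg.
HB.instance Definition _ := gen_choiceMixin dalg.

Definition joint_distribution (A : algType C) (phi : {scalar A})
    (x : 'I_k -> A) (mu : dalg) : Prop :=
  forall w : seq 'I_k, mu (\prod_(i <- w) ncX i) = phi (\prod_(i <- w) x i).

Definition Dc : set dalg := [set mu |
  exists (A : cstarAlgType R) (phi : {scalar A}) (x : 'I_k -> A),
    [/\ phi 1 = 1,
        forall a : A, 0 <= phi (star a * a),
        forall i, star (x i) = x i
      & joint_distribution phi x mu]].

Definition moment_series (mu : dalg) : series :=
  fun w => if w is [::] then 0 else mu (\prod_(i <- w) ncX i).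

Definition eta_series (mu : dalg) : series :=
  moment_series mu * (1 + moment_series mu)^-1.

Definition is_R_transform (mu : dalg) (r : series) : Prop :=
  r [::] = 0 /\
  ncsubst r (fun i => ncvar C i * (1 + moment_series mu)) = moment_series mu.

(* Here and below [xget d P] denotes the unique element of [P]: existence and
   uniqueness are the bijectivity of the eta-series and the R-transform, so the
   default [d] plays no role. *)
Definition R_transform (mu : dalg) : series := xget 0 (is_R_transform mu).

Definition boxplus_pow (t : R) (mu : dalg) : dalg :=
  xget mu [set nu | R_transform nu = t%:C%C *: R_transform mu].

Definition uplus_pow (t : R) (mu : dalg) : dalg :=
  xget mu [set nu | eta_series nu = t%:C%C *: eta_series mu].

Definition BB (t : R) (mu : dalg) : dalg :=
  uplus_pow (1 / (1 + t)) (boxplus_pow (1 + t) mu).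

Definition boolean_BP (mu : dalg) : dalg :=
  xget mu [set nu | R_transform nu = eta_series mu].

End Distributions.

(* Main.v *)
(** Write N for the eta-series of [BB t mu], eta for that of [mu], and
    G = (1 - t N)^-1. Unwinding the definitions, N is the unique solution of
    N G = eta(z_1 G, ..., z_k G). This equation composes additively in t, which
    is the semigroup law, and at t = 1 it says that the R-transform of [BB 1 mu]
    is eta.

    For positivity, realise [mu] by selfadjoint x_j and a state phi. On the full
    Fock space over the orthocomplement of the vacuum in the GNS space of phi,
    let Y_j be the sum of the creation and annihilation operators of the centred
    x_j, of the compression of x_j acting on the leftmost tensor factor, and of
    the scalar phi(x_j) on the vacuum and t phi(x_j) elsewhere, with the inner
    product multiplied by t for each tensor factor after the first. The vacuum
    distribution of the Y_j solves the equation above. The Y_j are bounded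
    because the form on tensors is a Schur product of positive semidefinite
    kernels, and because a selfadjoint h of norm at most 3/4 satisfies
    1 - h = (1 - y)^2. The C*-algebra carrying the new distribution is the
    separated completion of the algebra of bounded adjointable operators. *)
From HB Require Import structures.
Require Import Defs.
From mathcomp Require Import all_boot all_order all_algebra.
From mathcomp Require Import finmap all_classical all_reals.
From mathcomp Require Import topology normedtype sequences.
From mathcomp Require Import complex.
From mathcomp Require Import ring lra generic_quotient.
From mathcomp Require Import -(notations) monalg.

Set Implicit Arguments.
Unset Strict Implicit.
Unset Printing Implicit Defensive.

Import Order.TTheory GRing.Theory Num.Theory.
Import numFieldNormedType.Exports.
Local Open Scope classical_set_scope.
Local Open Scope ring_scope.

(** * Substitution of z_i G in noncommutative series *)

(** Substituting z_i G in the equation that defines the R-transform of [mu] turns it into the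
    corresponding equation for the free power, because G (1 + M_mu)(z_1 G, ..., z_k G) = (1 - (1 +
    t) N)^-1. One equation for N thus replaces both convolution powers, and being of fixed-point
    form it is solved degree by degree. Read letter by letter, the same equation is a first-passage
    recursion. The factor G of z_i G is an excursion inserted between two letters; it produces a
    quadratic term with coefficient t, the creation of a new tensor factor that has to be removed
    before the old one. This dictates the Fock model and the place of t in it. Nothing on the
    Hilbert space side is separated or completed. The Fock space is the free module on words in the
    algebra itself; the covariance form kills the unit, which does the work of passing to the
    orthocomplement of the vacuum, and multilinearity of tensors holds only up to null vectors. The
    price is that an operator does not determine its adjoint and that positivity is proved for
    kernels on words. Only the resulting operator algebra is completed, and then separated. *)

Section SeriesAlgebra.
Variables (K : comNzRingType) (k : nat).
Local Notation series := (ncseries K k).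
Implicit Types (f g h G H M N W : series) (w : seq 'I_k).

Lemma ncscaleAl (a : K) f g : a *: (f * g) = a *: f * g.
Proof. by apply: funext => w; rewrite ncscaleE -[RHS]/(ncmul _ _ _) ncmulZl. Qed.

Lemma ncscaleAr (a : K) f g : a *: (f * g) = f * (a *: g).
Proof.
apply: funext => w; rewrite ncscaleE !ncmulE mulr_sumr; apply: eq_bigr => i _.
by rewrite ncscaleE mulrCA.
Qed.

HB.instance Definition _ :=
  GRing.Lmodule_isLalgebra.Build K series ncscaleAl.
HB.instance Definition _ :=
  GRing.Lalgebra_isAlgebra.Build K series ncscaleAr.

Lemma ncmul0 f g : (f * g) [::] = f [::] * g [::].
Proof. exact: ncmul_nil. Qed.

Lemma ncmulS f g a w :
  (f * g) (a :: w) = f [::] * g (a :: w) + (nctail f a * g) w.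
Proof. exact: ncmul_cons. Qed.

Lemma nctailM f g a : nctail (f * g) a = f [::] *: nctail g a + nctail f a * g.
Proof. by apply: funext => w; rewrite /nctail ncmulS. Qed.

Lemma ncvar_mul0 i f : (ncvar K i * f) [::] = 0.
Proof. by rewrite ncmul0 /ncvar mul0r. Qed.

Lemma nctail_var i a : nctail (ncvar K i) a = (a == i)%:R *: 1.
Proof.
apply: funext => w; rewrite /nctail /ncvar ncscaleE nconeE eqseq_cons.
by rewrite -natrM mulnb.
Qed.

Lemma ncvar_mulS i f a w : (ncvar K i * f) (a :: w) = (a == i)%:R * f w.
Proof.
by rewrite ncmulS /ncvar mul0r add0r nctail_var -scalerAl mul1r.
Qed.

Lemma nctail0 a : nctail (0 : series) a = 0. Proof. by []. Qed.
Lemma nctail1 a : nctail (1 : series) a = 0.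
Proof. by apply: funext => w; rewrite /nctail nconeE. Qed.
Lemma nctailD f g a : nctail (f + g) a = nctail f a + nctail g a.
Proof. by []. Qed.
Lemma nctailZ (c : K) f a : nctail (c *: f) a = c *: nctail f a.
Proof. by []. Qed.

Lemma nctailP f g :
  f [::] = g [::] -> (forall a, nctail f a = nctail g a) -> f = g.
Proof.
move=> fg0 fg; apply: funext => -[//|a w].
exact: (congr1 (@^~ w) (fg a)).
Qed.

Definition zsubst G f : series := ncsubst f (fun i => ncvar K i * G).

Lemma zsubst_widen G f w m : (size w <= m)%N ->
  zsubst G f w = \sum_(n < m.+1) \sum_(u : n.-tuple 'I_k)
     f u * (\prod_(i <- u) (ncvar K i * G)) w.
Proof.
move=> wm; rewrite /zsubst /ncsubst.
rewrite (big_ord_widen m.+1 (fun n => \sum_(u : n.-tuple 'I_k)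
     f u * (\prod_(i <- u) (ncvar K i * G)) w)) //.
rewrite big_mkcond; apply: eq_bigr => n _; case: ltnP => // wn.
rewrite big1 // => u _; rewrite ncprod_size ?mulr0 ?size_tuple // => i.
exact: ncvar_mul0.
Qed.

Lemma sum_tuple0 (V : nmodType) (F : seq 'I_k -> V) :
  \sum_(u : 0.-tuple 'I_k) F u = F [::].
Proof.
by rewrite (bigD1 [tuple]) //= big1 ?addr0 // => u; rewrite (tuple0 u).
Qed.

Lemma zsubst_nil G f : zsubst G f [::] = f [::].
Proof.
rewrite /zsubst /ncsubst big_ord_recl big_ord0 addr0.
rewrite (sum_tuple0 (fun u => f u * (\prod_(i <- u) (ncvar K i * G)) [::])).
by rewrite big_nil nconeE mulr1.
Qed.

Lemma sum_tuple_cons (V : nmodType) n (F : seq 'I_k -> V) :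
  \sum_(u : n.+1.-tuple 'I_k) F u =
  \sum_(i : 'I_k) \sum_(u : n.-tuple 'I_k) F (i :: u).
Proof.
rewrite pair_big /=.
rewrite (reindex (fun p : 'I_k * n.-tuple 'I_k => [tuple of p.1 :: p.2])) //=.
exists (fun u => (thead u, [tuple of behead u])) => [[i u] _|u _] /=.
  by congr pair; apply: val_inj.
by rewrite [u in RHS]tuple_eta.
Qed.

(** A product of factors z_i G starts with the letter of its first factor, so only the monomials of
    [f] that begin with [a] contribute; once [a] is removed, a factor [G] is left in front. All
    later facts on substitution use this recursion instead of the double sum. *)
Lemma zsubst_cons G f a w :
  zsubst G f (a :: w) = (G * zsubst G (nctail f a)) w.
Proof.
rewrite {1}/zsubst /ncsubst [size (a :: w)]/= big_ord_recl.
rewrite (sum_tuple0 (fun u => f u * (\prod_(i <- u) (ncvar K i * G)) (a :: w))).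
rewrite big_nil nconeE mulr0 add0r ncmulE.
(* The inner sums are cut at the length of a suffix that varies with [i]; a common cut makes the
   sums exchangeable. *)
have widen (i : 'I_(size w).+1) : zsubst G (nctail f a) (drop i w) =
    \sum_(n < (size w).+1) \sum_(u : n.-tuple 'I_k)
      nctail f a u * (\prod_(i <- u) (ncvar K i * G)) (drop i w).
  by rewrite (@zsubst_widen _ _ _ (size w)) ?size_drop ?leq_subr.
transitivity (\sum_(i < (size w).+1) \sum_(n < (size w).+1)
    \sum_(u : n.-tuple 'I_k) G (take i w) *
      (nctail f a u * (\prod_(i <- u) (ncvar K i * G)) (drop i w))); last first.
  apply: eq_bigr => i _; rewrite widen mulr_sumr; apply: eq_bigr => n _.
  by rewrite mulr_sumr.
rewrite exchange_big; apply: eq_bigr => n _ /=.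
rewrite (sum_tuple_cons n (fun u => f u * (\prod_(i <- u) (ncvar K i * G)) (a :: w))).
rewrite (bigD1 a) //= [X in _ + X]big1 ?addr0 => [|i ia]; last first.
  rewrite big1 // => u _.
  by rewrite big_cons -mulrA ncvar_mulS eq_sym (negPf ia) mul0r mulr0.
rewrite [RHS]exchange_big; apply: eq_bigr => u _.
rewrite big_cons -mulrA ncvar_mulS eqxx mul1r ncmulE mulr_sumr.
by apply: eq_bigr => i _; rewrite mulrCA.
Qed.

Lemma nctail_zsubst G f a : nctail (zsubst G f) a = G * zsubst G (nctail f a).
Proof. by apply: funext => w; rewrite /nctail zsubst_cons. Qed.

Lemma zsubst_is_linear G : linear (zsubst G).
Proof.
move=> c f g; apply: funext => w.
rewrite ncaddE ncscaleE /zsubst /ncsubst mulr_sumr -big_split /=.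
apply: eq_bigr => n _; rewrite mulr_sumr -big_split /=; apply: eq_bigr => u _.
by rewrite ncaddE ncscaleE mulrDl mulrA.
Qed.

HB.instance Definition _ G :=
  GRing.isLinear.Build K series series _ (zsubst G) (zsubst_is_linear G).

(** Closeness in the degree filtration; it serves as the metric in the uniqueness and contraction
    arguments below. *)
Definition nceqn n f g := forall w, (size w < n)%N -> f w = g w.

Lemma nceqnP f g : (forall n, nceqn n f g) -> f = g.
Proof. by move=> fg; apply: funext => w; apply: (fg (size w).+1). Qed.

Lemma nceqnW m n f g : (m <= n)%N -> nceqn n f g -> nceqn m f g.
Proof. by move=> mn fg w wm; apply: fg; exact: leq_trans wm mn. Qed.

Lemma nceqnM n f f' g g' :
  nceqn n f f' -> nceqn n g g' -> nceqn n (f * g) (f' * g').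
Proof.
move=> ff gg w wn; rewrite !ncmulE; apply: eq_bigr => i _.
rewrite ff ?gg // ?size_drop ?size_take_min.
  by rewrite (leq_ltn_trans (leq_subr _ _)).
by rewrite (leq_ltn_trans (geq_minr _ _)).
Qed.

Lemma nceqnS n f g : f [::] = g [::] ->
  (forall a, nceqn n (nctail f a) (nctail g a)) -> nceqn n.+1 f g.
Proof. by move=> fg0 fg [//|a w] wn; apply: (fg a). Qed.

(** Each factor z_i G carries one letter of its own, so an error in [G] reappears one degree higher.
    This gain makes W -> [zsubst (1 + t *: W) f] a contraction. *)
Lemma nceqn_zsubst n f G H :
  nceqn n G H -> nceqn n.+1 (zsubst G f) (zsubst H f).
Proof.
(* The induction is on the degree of the conclusion alone; the agreement of [G] and [H] stays at the
   fixed degree [n]. *)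
move=> GH; move: {1 3}n.+1 (leqnn n.+1) => m; elim: m f => [//|m IH] f mn.
apply: nceqnS; first by rewrite !zsubst_nil.
move=> a; rewrite !nctail_zsubst; apply: nceqnM; last by apply: IH; exact: ltnW.
exact: nceqnW GH.
Qed.

Lemma zsubst1 G : zsubst G 1 = 1.
Proof.
apply: nctailP => [|a]; first by rewrite zsubst_nil.
by rewrite nctail_zsubst nctail1 linear0 mulr0.
Qed.

Lemma zsubstM G f g : zsubst G (f * g) = zsubst G f * zsubst G g.
Proof.
apply: nceqnP => n; elim: n f g => [//|n IH] f g; apply: nceqnS => [|a].
  by rewrite ncmul0 !zsubst_nil ncmul0.
rewrite nctailM !nctail_zsubst nctailM linearP /= zsubst_nil mulrDr -scalerAr.
move=> w wn; rewrite !ncaddE; congr (_ + _).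
by rewrite -mulrA; apply: (nceqnM _ (IH _ _)) wn.
Qed.

Lemma zsubst_is_monoid_morphism G : monoid_morphism (zsubst G).
Proof. by split; [exact: zsubst1|exact: zsubstM]. Qed.

HB.instance Definition _ G :=
  GRing.isMonoidMorphism.Build series series (zsubst G)
    (zsubst_is_monoid_morphism G).

(** Replacing z_i by z_i H inside z_i G gives z_i H G(z_1 H, ..., z_k H): substitutions compose by
    this twisted product of their series. Both the semigroup law and the treatment of the free power
    rest on it. *)
Lemma zsubst_comp G H f : zsubst H (zsubst G f) = zsubst (H * zsubst H G) f.
Proof.
apply: nceqnP => n; elim: n f => [//|n IH] f; apply: nceqnS => [|a].
  by rewrite !zsubst_nil.
rewrite !nctail_zsubst rmorphM /= mulrA.
by apply: nceqnM (IH _).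
Qed.

Lemma zsubst_inj G : G \is a GRing.unit -> injective (zsubst G).
Proof.
move=> Gu f g fg; apply: nceqnP => n; elim: n f g fg => [//|n IH] f g fg.
apply: nceqnS => [|a]; first by rewrite -(zsubst_nil G) fg zsubst_nil.
by apply: IH; apply: (mulrI Gu); rewrite -!nctail_zsubst fg.
Qed.

(** Inverts the recursion [nctail_zsubst]: after a letter is stripped, the factor [G] is divided
    out. With [G] equal to 1 + M_mu it produces the R-transform. *)
Fixpoint zunsubst G f w : K :=
  if w is a :: u then zunsubst G (G^-1 * nctail f a) u else f [::].

Lemma zunsubstK G : G \is a GRing.unit -> cancel (zunsubst G) (zsubst G).
Proof.
move=> Gu f; apply: nceqnP => n; elim: n f => [//|n IH] f.
apply: nceqnS => [|a]; first by rewrite zsubst_nil.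
rewrite nctail_zsubst -[X in nceqn _ _ X](mulVKr Gu).
exact: nceqnM (IH _).
Qed.

(** By [nceqn_zsubst], agreement of two solutions improves by one degree per application. The case
    [t] = 1 with [f] an R-transform recovers the moment series from it. *)
Lemma zfix_uniq t f W W' : W = zsubst (1 + t *: W) f ->
  W' = zsubst (1 + t *: W') f -> W = W'.
Proof.
move=> WE W'E; apply: nceqnP => n; elim: n => [//|n IH].
rewrite WE W'E; apply: nceqn_zsubst => w wn.
by rewrite !ncaddE !ncscaleE IH.
Qed.

Lemma zfix_exists t f : exists W, W = zsubst (1 + t *: W) f.
Proof.
pose F W := zsubst (1 + t *: W) f.
have FS n W W' : nceqn n W W' -> nceqn n.+1 (F W) (F W').
  by move=> e; apply: nceqn_zsubst => w wn; rewrite !ncaddE !ncscaleE e.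
have Fn n m : nceqn n (iter n F 0) (iter (n + m) F 0).
  by elim: n => [//|n IH]; exact: FS.
(* Coefficients on words shorter than n are frozen after n iterations, so the length of [w] plus one
   iterations suffice. *)
pose W : series := fun w => iter (size w).+1 F 0 w.
have WF n : nceqn n W (iter n F 0).
  by move=> w wn; rewrite /W (Fn _ (n - (size w).+1)%N) // subnKC.
exists W; apply: nceqnP => -[//|n] w wn.
exact: etrans (WF n.+1 w wn) (esym (FS n _ _ (WF n) w wn)).
Qed.

Lemma unit_1B t f : f [::] = 0 -> 1 - t *: f \is a GRing.unit.
Proof.
by move=> f0; rewrite ncunit_const1 // ncaddE ncoppE ncscaleE f0 mulr0 subr0.
Qed.

Lemma unit_1D f : f [::] = 0 -> 1 + f \is a GRing.unit.
Proof. by move=> f0; rewrite ncunit_const1 // ncaddE f0 addr0. Qed.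

(* For f = eta_mu this characterises N = eta_nu for nu = BB t mu ([BB_eq]). *)
Definition evol (t : K) (f N : series) :=
  N [::] = 0 /\ N * (1 - t *: N)^-1 = zsubst (1 - t *: N)^-1 f.

Lemma resolventE t N : N [::] = 0 ->
  (1 - t *: N)^-1 = 1 + t *: (N * (1 - t *: N)^-1).
Proof.
move=> N0; apply: (mulIr (unit_1B t N0)).
by rewrite mulVr ?unit_1B // mulrDl mul1r -scalerAl divrK ?unit_1B // subrK.
Qed.

(** In the unknown W = N G the resolvent identity gives G = 1 + t W, and the equation becomes the
    fixed-point equation of [zfix_exists]; N is then W (1 + t W)^-1. *)
Lemma evol_exists t f : f [::] = 0 -> exists N, evol t f N.
Proof.
move=> f0; have [W WE] := zfix_exists t f.
have W0 : W [::] = 0 by rewrite WE zsubst_nil.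
have tW0 : (t *: W) [::] = 0 by rewrite ncscaleE W0 mulr0.
pose N := W * (1 + t *: W)^-1.
have N0 : N [::] = 0 by rewrite /N ncmul0 W0 mul0r.
have NE : (1 - t *: N)^-1 = 1 + t *: W.
  rewrite -[RHS]invrK; congr _^-1; apply: (mulIr (unit_1D tW0)).
  by rewrite mulVr ?unit_1D // mulrBl mul1r -scalerAl divrK ?unit_1D ?addrK.
exists N; split=> //; rewrite NE -WE /N mulrVK //; exact: unit_1D.
Qed.

Lemma evol_comp s t f N N' : evol t f N -> evol s N N' -> evol (s + t) f N'.
Proof.
move=> [N0 NE] [N'0 N'E]; split=> //.
set G := (1 - t *: N)^-1 in NE; set G' := (1 - s *: N')^-1 in N'E.
have Gu : G \is a GRing.unit by rewrite unitrV unit_1B.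
have G'u : G' \is a GRing.unit by rewrite unitrV unit_1B.
have h0 : (N' * G') [::] = 0 by rewrite ncmul0 N'0 mul0r.
(* The inverse of the left side is (1 - t N' G')(1 - s N'), where G' (1 - s N') = 1; the two
   parameters therefore add up. *)
have GG : G' * zsubst G' G = (1 - (s + t) *: N')^-1.
  rewrite /G rmorphV ?unit_1B // rmorphB /= rmorph1 linearZ /= -N'E.
  rewrite -invrM ?unit_1B //; congr _^-1.
  rewrite mulrBl mul1r -scalerAl divrK ?unit_1B //.
  by rewrite scalerDl opprD addrA.
have /(congr1 (zsubst G')) := NE.
rewrite zsubst_comp GG rmorphM /= -N'E -mulrA => <-.
by rewrite -GG.
Qed.

End SeriesAlgebra.

(** * Distributions and their series *)

Section LinearExtension.
Variables (K : choiceType) (S : comNzRingType) (V : lmodType S) (h : K -> V).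

Definition malg_lin (g : malg K S) : V := \sum_(k <- msupp g) mcoeff k g *: h k.

Lemma malg_linEw (d : {fset K}) g : (msupp g `<=` d)%fset ->
  malg_lin g = \sum_(k <- d) mcoeff k g *: h k.
Proof.
move=> le; rewrite [LHS](big_fset_incl _ le) => //= x xd /mcoeff_outdom ->.
by rewrite scale0r.
Qed.

Lemma malg_lin_is_linear : linear malg_lin.
Proof.
move=> c f g; pose d := (msupp f `|` msupp g)%fset.
rewrite !(@malg_linEw d) ?fsubsetUl ?fsubsetUr //; last first.
  apply: fsubset_trans (msuppD_le _ _) _.
  by rewrite fsetSU // msuppZ_le.
rewrite scaler_sumr -big_split /=; apply: eq_bigr => x _.
by rewrite mcoeffD mcoeffZ scalerDl scalerA.
Qed.

HB.instance Definition _ :=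
  GRing.isLinear.Build S (malg K S) V _ malg_lin malg_lin_is_linear.

Lemma malg_linU c x : malg_lin (mkmalgU x c) = c *: h x.
Proof. by rewrite (malg_linEw msuppU_le) big_seq_fset1 mcoeffUU. Qed.

Lemma malg_sumU (g : malg K S) :
  g = \sum_(x <- msupp g) mcoeff x g *: mkmalgU x 1.
Proof.
rewrite {1}(monalgE g); apply: eq_bigr => x _; apply/malgP => y.
by rewrite mcoeffZ !mcoeffU; case: eqP; rewrite ?mulr1 ?mulr0.
Qed.

End LinearExtension.

Section DistributionSeries.
Variables (R : realType) (k : nat).
Local Notation C := R[i].
Local Notation series := (ncseries C k).
Implicit Types (mu nu : dalg R k) (w : seq 'I_k) (f M N r : series).

Lemma ncX_prod w :
  \prod_(i <- w) ncX R i = mkmalgU (fmonom_of_seq fmonom_key w) 1 :> ncpoly R k.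
Proof.
elim: w => [|i w IH]; rewrite ?big_nil ?big_cons ?IH.
  by rewrite -[RHS]/(mkmalgU (mone : fmonom _) 1).
rewrite /ncX malgM_def fgmulUU mulr1.
by congr mkmalgU; rewrite -[LHS]/(fmmul _ _) fmmulE fmuE !fmE.
Qed.

Lemma scalar_eq (V : lmodType C) (f g : {scalar V}) : f =1 g -> f = g.
Proof.
case: f g => f [[[f0 fD]] [fs]] [g [[[g0 gD]] [gs]]] /= fg.
have e : f = g by apply: funext.
subst g; congr (GRing.Linear.Pack (GRing.Linear.Class _ _)).
  by congr Algebra.isNmodMorphism.Axioms_; exact: Prop_irrelevance.
by congr GRing.isScalable.Axioms_; exact: Prop_irrelevance.
Qed.

Lemma dalg_ext mu nu :
  (forall w, mu (\prod_(i <- w) ncX R i) = nu (\prod_(i <- w) ncX R i)) ->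
  mu = nu.
Proof.
move=> e; have : dalg_fun mu = dalg_fun nu.
  apply: scalar_eq => P; rewrite (malg_sumU P) !linear_sum /=.
  apply: eq_bigr => m _; rewrite !linearZ /=; congr (_ * _).
  by have := e m; rewrite ncX_prod fmE fmK.
case: mu nu {e} => mu mu1 [nu nu1] /= e; subst nu.
by congr Dalg; exact: Prop_irrelevance.
Qed.

(** Words form a basis of the polynomial algebra; surjectivity of the moment series and of the
    eta-series comes from here. *)
Lemma dalg_of_word_function (F : seq 'I_k -> C) : F [::] = 1 ->
  exists mu : dalg R k, forall w, mu (\prod_(i <- w) ncX R i) = F w.
Proof.
pose phi : ncpoly R k -> C := malg_lin (V := C^o) (fun m : fmonom 'I_k => F m).
have phi_scalar : scalar phi by exact: malg_lin_is_linear.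
pose lin := GRing.isLinear.Build _ _ _ _ _ phi_scalar.
pose psi : {scalar ncpoly R k} := HB.pack phi lin.
move=> F1; have phiE w : psi (\prod_(i <- w) ncX R i) = F w.
  rewrite ncX_prod -[LHS]/(malg_lin (V := C^o) _ _) malg_linU fmE /=.
  exact: mul1r.
have phi1 : psi 1 = 1 by rewrite -(phiE [::]) big_nil in F1.
by exists (Dalg phi1).
Qed.

Lemma moment_series_nil mu : moment_series mu [::] = 0. Proof. by []. Qed.

Lemma moment_series1D mu w :
  (1 + moment_series mu) w = mu (\prod_(i <- w) ncX R i).
Proof.
rewrite ncaddE nconeE; case: w => [|i w] /=; last by rewrite add0r.
by rewrite addr0 big_nil dalg1.
Qed.

Lemma moment_series_inj mu nu : moment_series mu = moment_series nu -> mu = nu.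
Proof.
by move=> e; apply: dalg_ext => w; rewrite -!moment_series1D e.
Qed.

Lemma moment_series_onto M : M [::] = 0 ->
  exists mu : dalg R k, moment_series mu = M.
Proof.
move=> M0; have [|mu muE] := @dalg_of_word_function (1 + M).
  by rewrite ncaddE M0 addr0.
exists mu; apply: (addrI 1); apply: funext => w.
by rewrite moment_series1D muE.
Qed.

Lemma eta_seriesE mu : 1 - eta_series mu = (1 + moment_series mu)^-1.
Proof.
apply: (mulIr (unit_1D (moment_series_nil mu))).
by rewrite mulVr ?unit_1D // mulrBl mul1r divrK ?unit_1D // addrK.
Qed.

Lemma eta_series_nil mu : eta_series mu [::] = 0.
Proof. by rewrite /eta_series ncmul0 mul0r. Qed.

Lemma moment_seriesE mu : 1 + moment_series mu = (1 - eta_series mu)^-1.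
Proof. by rewrite eta_seriesE invrK. Qed.

Lemma eta_series_inj mu nu : eta_series mu = eta_series nu -> mu = nu.
Proof.
move=> e; apply/moment_series_inj/(addrI 1).
by rewrite !moment_seriesE e.
Qed.

Lemma eta_series_onto N : N [::] = 0 -> exists mu : dalg R k, eta_series mu = N.
Proof.
move=> N0; have N1 : 1 - N \is a GRing.unit by rewrite -[N]scale1r unit_1B.
have [|mu muE] := @moment_series_onto ((1 - N)^-1 - 1).
  rewrite -[N]scale1r resolventE // scale1r addrAC subrr add0r.
  by rewrite ncmul0 N0 mul0r.
exists mu; apply: (addrI (- 1)); apply: oppr_inj; rewrite opprD opprK.
by rewrite eta_seriesE muE addrC subrK invrK opprD opprK.
Qed.

Lemma R_transform_exists mu : exists r, is_R_transform mu r.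
Proof.
have u := unit_1D (moment_series_nil mu).
exists (zunsubst (1 + moment_series mu) (moment_series mu)).
by split=> //; exact: zunsubstK.
Qed.

Lemma R_transformP mu : is_R_transform mu (R_transform mu).
Proof.
rewrite /R_transform; case: xgetP => [_ _ //|noR].
by have [r /noR] := R_transform_exists mu.
Qed.

Lemma R_transform_eq mu r : is_R_transform mu r -> R_transform mu = r.
Proof.
move=> [_ rE]; have [_ RE] := R_transformP mu.
apply: (zsubst_inj (unit_1D (moment_series_nil mu))).
exact: etrans RE (esym rE).
Qed.

Lemma R_transform_inj mu nu : R_transform mu = R_transform nu -> mu = nu.
Proof.
move=> e; apply: moment_series_inj.
apply: (@zfix_uniq _ _ 1 (R_transform mu)); rewrite scale1r.
  by have [_ /esym] := R_transformP mu.
by rewrite e; have [_ /esym] := R_transformP nu.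
Qed.

Lemma xget_unique (T : choiceType) (d x : T) (P : set T) :
  P x -> (forall y, P y -> y = x) -> xget d P = x.
Proof. by move=> Px uniq; case: xgetP => [y -> /uniq //|/(_ x)]. Qed.

Lemma boxplus_pow_eq t mu nu :
  R_transform nu = t%:C%C *: R_transform mu -> boxplus_pow t mu = nu.
Proof.
move=> e; apply: xget_unique => // y /= ye.
by apply: R_transform_inj; rewrite ye e.
Qed.

Lemma uplus_pow_eq t mu nu :
  eta_series nu = t%:C%C *: eta_series mu -> uplus_pow t mu = nu.
Proof.
move=> e; apply: xget_unique => // y /= ye.
by apply: eta_series_inj; rewrite ye e.
Qed.

(** The Boolean power divides the eta-series by 1 + t, so the free power must be the [nu'] with
    eta-series (1 + t) N. That this candidate has the right R-transform is read off the equation for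
    R_mu after z_i is replaced by z_i G. *)
Lemma BB_eq (t : R) mu nu : 0 <= t ->
  evol t%:C%C (eta_series mu) (eta_series nu) -> BB t mu = nu.
Proof.
move=> t0 [N0]; set N := eta_series nu in N0 *; set G := (1 - _)^-1 => NE.
have s0 : (1 + t)%:C%C != 0 :> C.
  by rewrite (inj_eq (@complexI _)) gt_eqF // ltr_pwDl.
have [|nu' nu'E] := @eta_series_onto ((1 + t)%:C%C *: N).
  by rewrite ncscaleE N0 mulr0.
rewrite /BB (@boxplus_pow_eq _ _ nu'); last first.
  apply: R_transform_eq; split; first by rewrite ncscaleE (R_transformP mu).1 mulr0.
  have Gu : G \is a GRing.unit by rewrite unitrV unit_1B.
  have NG0 : (N * G) [::] = 0 by rewrite ncmul0 N0 mul0r.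
  have NGu : 1 - N * G \is a GRing.unit by rewrite -[N * G]scale1r unit_1B.
  have sNu : 1 - (1 + t)%:C%C *: N \is a GRing.unit by rewrite unit_1B.
  have subst_mu : zsubst G (1 + moment_series mu) = (1 - N * G)^-1.
    rewrite moment_seriesE rmorphV /= ?rmorphB ?rmorph1 /= -?NE //.
    by rewrite -[eta_series mu]scale1r unit_1B // eta_series_nil.
  (* By [zsubst_comp] this identity carries the argument z_i (1 + M_mu) of R_mu into z_i (1 +
     M_nu'). *)
  have GG : G * zsubst G (1 + moment_series mu) = 1 + moment_series nu'.
    rewrite subst_mu moment_seriesE nu'E -invrM ?unit_1B //; congr _^-1.
    rewrite mulrBl mul1r /G divrK ?unit_1B // rmorphD /= rmorph1.
    by rewrite scalerDl scale1r opprD addrA addrAC.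
  rewrite -/(zsubst _ _) linearZ /= -GG -zsubst_comp.
  rewrite [zsubst _ (R_transform mu)](R_transformP mu).2.
  have -> : zsubst G (moment_series mu) = N * (G * (1 - N * G)^-1).
    apply: (addrI 1); transitivity (zsubst G (1 + moment_series mu)).
      by rewrite rmorphD rmorph1.
    rewrite subst_mu mulrA.
    by rewrite -{1}[N * G]scale1r resolventE // !scale1r.
  rewrite -subst_mu GG; apply: (addrI 1).
  by rewrite moment_seriesE nu'E [RHS]resolventE.
apply: uplus_pow_eq; rewrite nu'E scalerA -rmorphM /= div1r mulVf ?scale1r //.
by rewrite gt_eqF // ltr_pwDl.
Qed.

(** For t = 1 the series G is 1 + M_nu and N G is M_nu, so [evol] is literally the equation that
    makes [eta_series mu] the R-transform of [nu]. *)
Lemma boolean_BP_eq mu nu :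
  evol 1 (eta_series mu) (eta_series nu) -> boolean_BP mu = nu.
Proof.
move=> [N0]; rewrite scale1r -moment_seriesE => NE.
have Rnu : R_transform nu = eta_series mu.
  apply: R_transform_eq; split; first exact: eta_series_nil.
  rewrite -/(zsubst _ _) -NE /eta_series divrK //.
  exact/unit_1D/moment_series_nil.
apply: xget_unique => // y /= ye.
by apply: R_transform_inj; rewrite ye Rnu.
Qed.

End DistributionSeries.

(** * Bounded operators on spaces with a semi-inner product *)

Section ComplexFacts.
Variable R : realType.
Local Notation C := R[i].
Implicit Types (x y z : C).

Lemma sqr_normcE z : Normc.normc z ^+ 2 = complex.Re (z * z^*%C).
Proof.
case: z => a b /=; rewrite sqr_sqrtr ?addr_ge0 ?sqr_ge0 //.
by rewrite mulrN opprK !expr2.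
Qed.

Lemma normc_ge0 z : 0 <= Normc.normc z.
Proof. by case: z => a b; exact: sqrtr_ge0. Qed.

Lemma normc_real (a : R) : Normc.normc a%:C%C = `|a|.
Proof. by rewrite /= expr0n addr0 sqrtr_sqr. Qed.

Lemma Re_le_normc z : `|complex.Re z| <= Normc.normc z.
Proof.
case: z => a b /=; rewrite -[leLHS]sqrtr_sqr ler_sqrt ?lerDl ?sqr_ge0 //.
by rewrite addr_ge0 ?sqr_ge0.
Qed.

Lemma Im_le_normc z : `|complex.Im z| <= Normc.normc z.
Proof.
case: z => a b /=; rewrite -[leLHS]sqrtr_sqr ler_sqrt ?lerDr ?sqr_ge0 //.
by rewrite addr_ge0 ?sqr_ge0.
Qed.

Lemma ReD x y : complex.Re (x + y) = complex.Re x + complex.Re y.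
Proof. by case: x y => [a b] [c d]. Qed.

Lemma ImD x y : complex.Im (x + y) = complex.Im x + complex.Im y.
Proof. by case: x y => [a b] [c d]. Qed.

Lemma Re_realM (a : R) x : complex.Re (a%:C%C * x) = a * complex.Re x.
Proof. by case: x => [c d] /=; rewrite mul0r subr0. Qed.

Lemma ReJ x : complex.Re x^*%C = complex.Re x.
Proof. by case: x. Qed.

Lemma ge0_ReE x : 0 <= x -> x = (complex.Re x)%:C%C.
Proof. by case: x => a b; rewrite lecE /= => /andP[/eqP-> _]. Qed.

Lemma Re_ge0 x : 0 <= x -> 0 <= complex.Re x.
Proof. by case: x => a b; rewrite lecE /= => /andP[]. Qed.

End ComplexFacts.

(* [ip] may be degenerate, so adjoints are not determined by the operator and
   [boundedOp] below carries one. *)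
Record preHilbert (R : realType) := PreHilbert {
  ph_sort :> lmodType R[i];
  ip : ph_sort -> ph_sort -> R[i];
  ip_linear : forall x, scalar (ip x);
  ipC : forall x y, ip x y = (ip y x)^*%C;
  ip_ge0 : forall x, 0 <= ip x x;
  ph_vac : ph_sort;
  ip_vac : ip ph_vac ph_vac = 1
}.

Section PreHilbertTheory.
Variables (R : realType) (H : preHilbert R).
Local Notation C := R[i].
Implicit Types (x y z : H).

Lemma ip0r x : ip x 0 = 0.
Proof.
have := ip_linear x (-1) 0 0; rewrite scaler0 addr0 => ->.
by rewrite mulN1r addNr.
Qed.

Lemma ipDr x y z : ip x (y + z) = ip x y + ip x z.
Proof. by have := ip_linear x 1 y z; rewrite scale1r mul1r. Qed.

Lemma ipZr a x y : ip x (a *: y) = a * ip x y.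
Proof. by have := ip_linear x a y 0; rewrite !addr0 ip0r addr0. Qed.

Lemma ipDl x y z : ip (x + y) z = ip x z + ip y z.
Proof. by rewrite ipC ipDr rmorphD /= -!ipC. Qed.

Lemma ipZl a x y : ip (a *: x) y = a^*%C * ip x y.
Proof. by rewrite ipC ipZr rmorphM /= -ipC. Qed.

Lemma ip0l x : ip 0 x = 0. Proof. by rewrite ipC ip0r conjc0. Qed.

Definition nrm x : R := Num.sqrt (complex.Re (ip x x)).

Lemma nrm_ge0 x : 0 <= nrm x. Proof. exact: sqrtr_ge0. Qed.

Lemma sqr_nrm x : nrm x ^+ 2 = complex.Re (ip x x).
Proof. by rewrite sqr_sqrtr // Re_ge0 // ip_ge0. Qed.

Lemma nrm_vac : nrm (ph_vac H) = 1. Proof. by rewrite /nrm ip_vac sqrtr1. Qed.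

(** Cauchy-Schwarz for a form that may be degenerate: [b] is the squared modulus of the inner
    product, and [c], the squared norm of the second vector, may vanish. *)
Lemma discriminant_le (a b c : R) : 0 <= a -> 0 <= b -> 0 <= c ->
  (forall s, 0 <= a - 2 * s * b + s ^+ 2 * b * c) -> b <= a * c.
Proof.
move=> a0 b0 c0 pos; have [cE|cN0] := eqVneq c 0.
  have [bE|bN0] := eqVneq b 0; first by rewrite bE mulr_ge0.
  (* With [c] = 0 the expression is affine in s, and this s makes it equal to -1. *)
  have := pos ((a + 1) / (2 * b)); rewrite cE mulr0 addr0.
  have -> : 2 * ((a + 1) / (2 * b)) * b = a + 1 by field.
  lra.
(* 1 / [c] minimises the quadratic. *)
have := pos c^-1; have -> : a - 2 * c^-1 * b + c^-1 ^+ 2 * b * c = a - b / c by field.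
by rewrite subr_ge0 ler_pdivrMr // lt_def cN0.
Qed.

Lemma cauchy_schwarz x y : Normc.normc (ip x y) <= nrm x * nrm y.
Proof.
rewrite -(ler_pXn2r (n := 2)) ?nnegrE ?normc_ge0 ?mulr_ge0 ?nrm_ge0 //.
rewrite exprMn !sqr_nrm sqr_normcE; apply: discriminant_le.
- exact/Re_ge0/ip_ge0.
- exact/Re_ge0/mulcJ_ge0.
- exact/Re_ge0/ip_ge0.
(* The conjugate inner product in the coefficient fixes the phase, so that the cross terms become
   real multiples of its squared modulus. *)
move=> s; have := Re_ge0 (ip_ge0 (x - (s%:C%C * (ip x y)^*%C) *: y)).
rewrite -scaleNr !(ipDl, ipDr, ipZl, ipZr) rmorphN rmorphM /= conjcK.
rewrite (ipC y x) (ge0_ReE (ip_ge0 x)) (ge0_ReE (ip_ge0 y)).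
move: (complex.Re (ip x x)) (complex.Re (ip y y)) => a c.
case: (ip x y) => p q /= h; apply: le_trans h _; simpc => /=.
by rewrite le_eqVlt; apply/orP; left; apply/eqP; ring.
Qed.

Lemma nrmZ a x : nrm (a *: x) = Normc.normc a * nrm x.
Proof.
apply/eqP; rewrite -(eqrXn2 (n := 2)) ?mulr_ge0 ?nrm_ge0 ?normc_ge0 //.
rewrite exprMn !sqr_nrm sqr_normcE ipZl ipZr mulrA.
by rewrite (ge0_ReE (ip_ge0 x)) mulrC Re_realM /= mulrC [a^*%C * a]mulrC.
Qed.

Lemma nrmD x y : nrm (x + y) <= nrm x + nrm y.
Proof.
rewrite -(ler_pXn2r (n := 2)) ?nnegrE ?addr_ge0 ?nrm_ge0 // sqrrD !sqr_nrm.
rewrite ipDl !ipDr !ReD (ipC y x) ReJ.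
have := le_trans (ler_norm _) (le_trans (Re_le_normc (ip x y)) (cauchy_schwarz x y)).
by lra.
Qed.

End PreHilbertTheory.

Record boundedOp (R : realType) (H : preHilbert R) := BoundedOp {
  opf :> H -> H;
  opa : H -> H;
  opf_linear : linear opf;
  opa_linear : linear opa;
  op_adj : forall x y, ip (opf x) y = ip x (opa y);
  op_bounded : exists c, forall x, nrm (opf x) <= c * nrm x
}.

Section BoundedOps.
Variables (R : realType) (H : preHilbert R).
Local Notation C := R[i].
Local Notation op := (boundedOp H).
Implicit Types (x y z : H) (S T U : op).

Lemma op_ext S T : opf S =1 opf T -> opa S =1 opa T -> S = T.
Proof.
case: S T => [f a fl al ad bd] [g b gl bl bad bbd] /= fg ab.
have efg : f = g by apply: funext.
have eab : a = b by apply: funext.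
by subst; congr BoundedOp; exact: Prop_irrelevance.
Qed.

Lemma opfP S a x y : S (a *: x + y) = a *: S x + S y.
Proof. exact: opf_linear. Qed.

Lemma opaP S a x y : opa S (a *: x + y) = a *: opa S x + opa S y.
Proof. exact: opa_linear. Qed.

Lemma opfZ S a x : S (a *: x) = a *: S x.
Proof.
have S0 : S 0 = 0.
  by have := opfP S (-1) 0 0; rewrite scaler0 addr0 scaleN1r addNr.
by have := opfP S a x 0; rewrite S0 !addr0.
Qed.

Lemma opfD S x y : S (x + y) = S x + S y.
Proof. by have := opfP S 1 x y; rewrite !scale1r. Qed.

Lemma op_bounded_ge0 S : exists2 c, 0 <= c & forall x, nrm (S x) <= c * nrm x.
Proof.
have [c cP] := op_bounded S; exists `|c| => // x.
by rewrite (le_trans (cP x)) // ler_wpM2r ?nrm_ge0 ?ler_norm.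
Qed.

(** The squared norm of [opa S x] is the inner product of [S (opa S x)] with [x]; apply
    Cauchy-Schwarz and divide by the norm of [opa S x]. *)
Lemma op_adj_bound S c : 0 <= c ->
  (forall x, nrm (S x) <= c * nrm x) -> forall x, nrm (opa S x) <= c * nrm x.
Proof.
move=> c0 cP x; have [->|nz] := eqVneq (nrm (opa S x)) 0.
  by rewrite mulr_ge0 ?nrm_ge0.
have np : 0 < nrm (opa S x) by rewrite lt_def nz nrm_ge0.
rewrite -(ler_pM2l np) -expr2 sqr_nrm -op_adj.
rewrite (le_trans (ler_norm _)) // (le_trans (Re_le_normc _)) //.
rewrite (le_trans (cauchy_schwarz _ _)) // mulrCA.
by rewrite mulrA ler_wpM2r ?nrm_ge0.
Qed.

Program Definition op_zero : op := @BoundedOp R H (fun=> 0) (fun=> 0) _ _ _ _.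
Next Obligation. by move=> a x y; rewrite scaler0 addr0. Qed.
Next Obligation. by move=> a x y; rewrite scaler0 addr0. Qed.
Next Obligation. by move=> x y; rewrite ip0l ip0r. Qed.
Next Obligation.
by exists 0 => x; rewrite /nrm ip0r sqrtr0 mul0r.
Qed.

Program Definition op_one : op := @BoundedOp R H id id _ _ _ _.
Next Obligation. by []. Qed.
Next Obligation. by []. Qed.
Next Obligation. by []. Qed.
Next Obligation. by exists 1 => x; rewrite mul1r. Qed.

Program Definition op_add S T : op :=
  @BoundedOp R H (fun x => S x + T x) (fun x => opa S x + opa T x) _ _ _ _.
Next Obligation. by move=> S T a x y; rewrite !opfP scalerDr addrACA. Qed.
Next Obligation. by move=> S T a x y; rewrite !opaP scalerDr addrACA. Qed.
Next Obligation. by move=> S T x y; rewrite ipDl ipDr !op_adj. Qed.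
Next Obligation.
move=> S T; have [c cP] := op_bounded S; have [d dP] := op_bounded T.
exists (c + d) => x; rewrite mulrDl (le_trans (nrmD _ _)) // lerD //.
Qed.

Program Definition op_scale (a : C) S : op :=
  @BoundedOp R H (fun x => a *: S x) (fun x => a^*%C *: opa S x) _ _ _ _.
Next Obligation.
by move=> a S b x y; rewrite !opfP scalerDr !scalerA mulrC.
Qed.
Next Obligation.
by move=> a S b x y; rewrite !opaP scalerDr !scalerA mulrC.
Qed.
Next Obligation. by move=> a S x y; rewrite ipZl ipZr !op_adj. Qed.
Next Obligation.
move=> a S; have [c cP] := op_bounded S.
by exists (Normc.normc a * c) => x; rewrite nrmZ -mulrA ler_wpM2l ?normc_ge0.
Qed.

Program Definition op_mul S T : op :=
  @BoundedOp R H (fun x => S (T x)) (fun x => opa T (opa S x)) _ _ _ _.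
Next Obligation. by move=> S T a x y; rewrite !opfP. Qed.
Next Obligation. by move=> S T a x y; rewrite !opaP. Qed.
Next Obligation. by move=> S T x y; rewrite !op_adj. Qed.
Next Obligation.
move=> S T; have [c c0 cP] := op_bounded_ge0 S; have [d dP] := op_bounded T.
by exists (c * d) => x; rewrite -mulrA (le_trans (cP _)) // ler_wpM2l.
Qed.

Program Definition op_star S : op := @BoundedOp R H (opa S) (opf S) _ _ _ _.
Next Obligation. by move=> S; exact: opa_linear. Qed.
Next Obligation. by move=> S; exact: opf_linear. Qed.
Next Obligation. by move=> S x y; rewrite ipC -op_adj -ipC. Qed.
Next Obligation.
move=> S; have [c c0 cP] := op_bounded_ge0 S.
by exists c; exact: op_adj_bound.
Qed.

HB.instance Definition _ := gen_eqMixin op.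
HB.instance Definition _ := gen_choiceMixin op.

Let op_addA : associative op_add.
Proof. by move=> S T U; apply: op_ext => x /=; rewrite addrA. Qed.
Let op_addC : commutative op_add.
Proof. by move=> S T; apply: op_ext => x /=; rewrite addrC. Qed.
Let op_add0 : left_id op_zero op_add.
Proof. by move=> S; apply: op_ext => x /=; rewrite add0r. Qed.
Let op_addN : left_inverse op_zero (op_scale (-1)) op_add.
Proof.
move=> S; apply: op_ext => x; first by rewrite /= scaleN1r addNr.
by rewrite /op_add /op_scale /opa rmorphN1 scaleN1r addNr.
Qed.

HB.instance Definition _ :=
  GRing.isZmodule.Build op op_addA op_addC op_add0 op_addN.

Let op_mulA : associative op_mul.
Proof. by move=> S T U; apply: op_ext. Qed.
Let op_mul1l : left_id op_one op_mul.
Proof. by move=> S; apply: op_ext. Qed.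
Let op_mul1r : right_id op_one op_mul.
Proof. by move=> S; apply: op_ext. Qed.
Let op_mulDl : left_distributive op_mul op_add.
Proof.
move=> S T U; by apply: op_ext => x //=; exact: (opfD (op_star U)).
Qed.

Let op_mulDr : right_distributive op_mul op_add.
Proof.
move=> S T U; by apply: op_ext => x //=; exact: opfD.
Qed.

Let op_one_neq0 : op_one != op_zero :> op.
Proof.
apply/eqP => /(congr1 (fun S : op => nrm (S (ph_vac H)))) /eqP.
by rewrite /= nrm_vac /nrm ip0l sqrtr0 oner_eq0.
Qed.

HB.instance Definition _ := GRing.Zmodule_isNzRing.Build op
  op_mulA op_mul1l op_mul1r op_mulDl op_mulDr op_one_neq0.

Let op_scaleA (a b : C) S : op_scale a (op_scale b S) = op_scale (a * b) S.
Proof. by apply: op_ext => x /=; rewrite scalerA -?rmorphM. Qed.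
Let op_scale1 : left_id 1 op_scale.
Proof.
move=> S; apply: op_ext => x; first by rewrite /= scale1r.
by rewrite /op_scale /opa conjc1 scale1r.
Qed.

Let op_scaleDr : right_distributive op_scale +%R.
Proof. by move=> a S T; apply: op_ext => x /=; rewrite scalerDr. Qed.
Let op_scaleDl S : {morph op_scale^~ S : a b / a + b}.
Proof. by move=> a b; apply: op_ext => x /=; rewrite ?rmorphD scalerDl. Qed.

HB.instance Definition _ := GRing.Zmodule_isLmodule.Build C op
  op_scaleA op_scale1 op_scaleDr op_scaleDl.

Lemma op_scaleAl (a : C) S T : a *: (S * T) = a *: S * T.
Proof.
by apply: op_ext => x //=; exact/esym/(opfZ (op_star T)).
Qed.

Lemma op_scaleAr (a : C) S T : a *: (S * T) = S * (a *: T).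
Proof.
by apply: op_ext => x //=; exact/esym/opfZ.
Qed.

HB.instance Definition _ := GRing.Lmodule_isLalgebra.Build C op op_scaleAl.
HB.instance Definition _ := GRing.Lalgebra_isAlgebra.Build C op op_scaleAr.

End BoundedOps.

(** * The operator seminorm and its C*-identity *)

Section OperatorNorm.
Variables (R : realType) (H : preHilbert R).
Local Notation C := R[i].
Local Notation op := (boundedOp H).
Implicit Types (x y z : H) (S T U : op).

Definition opnorm S : R :=
  inf [set c | 0 <= c /\ forall x, nrm (S x) <= c * nrm x]%classic.

Lemma opnorm_ge0 S : 0 <= opnorm S.
Proof.
have [c c0 cP] := op_bounded_ge0 S.
by apply: lb_le_inf; [exists c | move=> d []].
Qed.

Lemma opnorm_le S c : 0 <= c -> (forall x, nrm (S x) <= c * nrm x) ->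
  opnorm S <= c.
Proof. by move=> c0 cP; apply: ge_inf => //; exists 0 => d []. Qed.

Lemma opnormP S x : nrm (S x) <= opnorm S * nrm x.
Proof.
have [c c0 cP] := op_bounded_ge0 S.
have [x0|xN0] := eqVneq (nrm x) 0.
  by have := cP x; rewrite x0 !mulr0.
have xp : 0 < nrm x by rewrite lt_def xN0 nrm_ge0.
rewrite -ler_pdivrMr //; apply: lb_le_inf; first by exists c.
by move=> d [_ dP]; rewrite ler_pdivrMr.
Qed.

Lemma opnormD S T : opnorm (S + T) <= opnorm S + opnorm T.
Proof.
apply: opnorm_le => [|x]; first by rewrite addr_ge0 ?opnorm_ge0.
by rewrite mulrDl (le_trans (nrmD _ _)) // lerD ?opnormP.
Qed.

Lemma opnormM S T : opnorm (S * T) <= opnorm S * opnorm T.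
Proof.
apply: opnorm_le => [|x]; first by rewrite mulr_ge0 ?opnorm_ge0.
rewrite -mulrA (le_trans (opnormP S (T x))) // ler_wpM2l ?opnorm_ge0 //.
exact: opnormP.
Qed.

Lemma opnormZ_le a S : opnorm (a *: S) <= Normc.normc a * opnorm S.
Proof.
apply: opnorm_le => [|x]; first by rewrite mulr_ge0 ?opnorm_ge0 ?normc_ge0.
by rewrite [X in nrm X <= _]/(_ *: _) nrmZ -mulrA ler_wpM2l ?normc_ge0 ?opnormP.
Qed.

Lemma opnormZ a S : opnorm (a *: S) = Normc.normc a * opnorm S.
Proof.
have [->|a0] := eqVneq a 0.
  rewrite Normc.normc0 mul0r; apply/eqP; rewrite eq_le opnorm_ge0 andbT.
  by rewrite (le_trans (opnormZ_le _ _)) // Normc.normc0 mul0r.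
have np : 0 < Normc.normc a.
  rewrite lt_def normc_ge0 andbT; apply: contra a0 => /eqP.
  by move/Normc.eq0_normc->.
apply/eqP; rewrite eq_le opnormZ_le /= -ler_pdivlMl //.
by rewrite -Normc.normcV -[X in opnorm X <= _](scalerK a0) opnormZ_le.
Qed.

Lemma opnorm_adj_le S : opnorm (op_star S) <= opnorm S.
Proof.
apply: opnorm_le => [|x]; first exact: opnorm_ge0.
by apply: op_adj_bound; [exact: opnorm_ge0|exact: opnormP].
Qed.

Lemma op_starK : involutive (@op_star R H).
Proof. by move=> S; apply: op_ext. Qed.

Lemma op_starD S T : op_star (S + T) = op_star S + op_star T.
Proof. exact: op_ext. Qed.

Lemma op_starZ a S : op_star (a *: S) = a^*%C *: op_star S.
Proof. by apply: op_ext => x //=; rewrite conjcK. Qed.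

Lemma op_starM S T : op_star (S * T) = op_star T * op_star S.
Proof. exact: op_ext. Qed.

(** One inequality is submultiplicativity together with [opnorm_adj_le]. The other holds because the
    squared norm of [S x] is the inner product of [x] with [op_star S] applied to [S x]. *)
Lemma opnorm_star S : opnorm (op_star S * S) = opnorm S ^+ 2.
Proof.
apply/eqP; rewrite eq_le; apply/andP; split.
  rewrite (le_trans (opnormM _ _)) // expr2 ler_wpM2r ?opnorm_ge0 //.
  exact: opnorm_adj_le.
have n0 := opnorm_ge0 (op_star S * S).
rewrite -[leRHS]sqr_sqrtr // ler_pXn2r ?nnegrE ?sqrtr_ge0 ?opnorm_ge0 //.
apply: opnorm_le => [|x]; first exact: sqrtr_ge0.
rewrite -(ler_pXn2r (n := 2)) ?nnegrE ?mulr_ge0 ?sqrtr_ge0 ?nrm_ge0 //.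
rewrite exprMn (sqr_nrm (S x)) sqr_sqrtr // op_adj.
rewrite (le_trans (ler_norm _)) // (le_trans (Re_le_normc _)) //.
rewrite (le_trans (cauchy_schwarz _ _)) // mulrC expr2 mulrA ler_wpM2r ?nrm_ge0 //.
exact: (opnormP (op_star S * S)).
Qed.

Lemma op_state_le S : Normc.normc (ip (ph_vac H) (S (ph_vac H))) <= opnorm S.
Proof.
rewrite (le_trans (cauchy_schwarz _ _)) // nrm_vac mul1r.
by rewrite (le_trans (opnormP _ _)) // nrm_vac mulr1.
Qed.

End OperatorNorm.

(** * Completion of a C*-seminormed algebra with a state *)

(** A C*-probability space lacking only separation and completeness. Cauchy sequences in such an
    algebra form another one, which lets completion and separation be done one after the other. The
    bound [pstate_le] is what extends the state to limits. *)
Record preCstar (R : realType) := PreCstar {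
  pc :> algType R[i];
  pstar : pc -> pc;
  pnorm : pc -> R;
  pstarD : forall x y, pstar (x + y) = pstar x + pstar y;
  pstarZ : forall a x, pstar (a *: x) = a^*%C *: pstar x;
  pstarM : forall x y, pstar (x * y) = pstar y * pstar x;
  pstarK : forall x, pstar (pstar x) = x;
  pnorm_ge0 : forall x, 0 <= pnorm x;
  pnormD : forall x y, pnorm (x + y) <= pnorm x + pnorm y;
  pnormZ : forall a x, pnorm (a *: x) = Normc.normc a * pnorm x;
  pnormM : forall x y, pnorm (x * y) <= pnorm x * pnorm y;
  pnorm_star : forall x, pnorm (pstar x * x) = pnorm x ^+ 2;
  pstate : {scalar pc};
  pstate1 : pstate 1 = 1;
  pstate_ge0 : forall x, 0 <= pstate (pstar x * x);
  pstate_le : forall x, Normc.normc (pstate x) <= pnorm x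
}.

Section OperatorPreCstar.
Variables (R : realType) (H : preHilbert R).
Local Notation C := R[i].
Local Notation op := (boundedOp H).
Let state (S : op) : C := ip (ph_vac H) (S (ph_vac H)).
Let state_scalar : scalar state.
Proof. by move=> a S T; rewrite /state -[LHS]/(ip _ (_ *: _ + _)) ipDr ipZr. Qed.
HB.instance Definition _ := GRing.isLinear.Build C op C *%R state state_scalar.

Lemma op_state_ge0 (S : op) : 0 <= state (op_star S * S).
Proof. by rewrite /state -[X in ip _ X]/(opa S (S _)) -op_adj ip_ge0. Qed.

Definition op_preCstar : preCstar R :=
  @PreCstar R op (@op_star R H) (@opnorm R H) (@op_starD R H) (@op_starZ R H)
    (@op_starM R H) (@op_starK R H) (@opnorm_ge0 R H) (@opnormD R H)
    (@opnormZ R H) (@opnormM R H) (@opnorm_star R H) state (ip_vac H)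
    op_state_ge0 (@op_state_le R H).

End OperatorPreCstar.

Lemma cauchy_cvgn (R : realType) (u : nat -> R) :
  (forall e, 0 < e -> exists N, forall m n, (N <= m)%N -> (N <= n)%N ->
     `|u m - u n| < e) -> cvgn u.
Proof.
move=> h; apply: cauchy_cvg; apply: cauchy_exP => e /h[N NP].
by exists (u N), N => // n /= Nn; apply: NP.
Qed.

Section ReIm.
Variable R : realType.
Implicit Types (x y : R[i]).

Lemma complex_eta x : Complex (complex.Re x) (complex.Im x) = x.
Proof. by case: x. Qed.

Lemma mulJ_Re x : complex.Re (x * x^*%C) =
  complex.Re x * complex.Re x + complex.Im x * complex.Im x.
Proof. by case: x => a b /=; rewrite mulrN opprK. Qed.

Lemma ReM x y : complex.Re (x * y) =
  complex.Re x * complex.Re y - complex.Im x * complex.Im y.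
Proof. by case: x y => [a b] [c d]. Qed.

Lemma ImM x y : complex.Im (x * y) =
  complex.Re x * complex.Im y + complex.Im x * complex.Re y.
Proof. by case: x y => [a b] [c d]. Qed.
End ReIm.

Section PreCstarTheory.
Variables (R : realType) (P : preCstar R).
Implicit Types (x y : P).

Lemma pnorm0 : pnorm (0 : P) = 0.
Proof. by rewrite -(scale0r (0 : P)) pnormZ Normc.normc0 mul0r. Qed.

Lemma pnormN x : pnorm (- x) = pnorm x.
Proof.
rewrite -scaleN1r pnormZ -[in LHS](rmorphN1 (real_complex R)).
by rewrite normc_real normrN1 mul1r.
Qed.

Lemma pnormBC x y : pnorm (x - y) = pnorm (y - x).
Proof. by rewrite -opprB pnormN. Qed.

Lemma pnorm_dist x y : `|pnorm x - pnorm y| <= pnorm (x - y).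
Proof.
rewrite ler_norml; apply/andP; split.
  by rewrite lerNl opprB lerBlDr -[X in pnorm X <= _](subrK x) pnormBC pnormD.
by rewrite lerBlDr -[X in pnorm X <= _](subrK y) pnormD.
Qed.

Lemma pnorm_split x y z : pnorm (x - z) <= pnorm (x - y) + pnorm (y - z).
Proof. by rewrite (_ : x - z = (x - y) + (y - z)) ?pnormD // addrA subrK. Qed.

Lemma pstarN x : pstar (- x) = - pstar x.
Proof. by rewrite -scaleN1r pstarZ rmorphN1 scaleN1r. Qed.

Lemma pstarB x y : pstar (x - y) = pstar x - pstar y.
Proof. by rewrite pstarD pstarN. Qed.

(** The C*-identity bounds the square of the seminorm of y by the product of those of [pstar y] and
    y; cancel one factor and exchange the roles. *)
Lemma pnorm_pstar x : pnorm (pstar x) = pnorm x.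
Proof.
have le_star y : pnorm y <= pnorm (pstar y).
  have [->|y0] := eqVneq (pnorm y) 0; first exact: pnorm_ge0.
  have yp : 0 < pnorm y by rewrite lt_def y0 pnorm_ge0.
  by rewrite -(ler_pM2r yp) -expr2 -pnorm_star pnormM.
by apply/eqP; rewrite eq_le -{2}[x]pstarK !le_star.
Qed.

Lemma pstate_dist x y : Normc.normc (pstate P x - pstate P y) <= pnorm (x - y).
Proof. by rewrite -raddfB pstate_le. Qed.

End PreCstarTheory.

(** Sequences, not classes of sequences: those that differ by a null sequence are identified later,
    by the separation quotient. *)
Record cauchySeq (R : realType) (P : preCstar R) := CauchySeq {
  cseq :> nat -> P;
  cseqP : forall e, 0 < e -> exists N, forall m n, (N <= m)%N -> (N <= n)%N ->
    pnorm (cseq m - cseq n) < e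
}.

Section CauchySeqs.
Variables (R : realType) (P : preCstar R).
Local Notation C := R[i].
Local Notation S := (cauchySeq P).
Implicit Types (x y z : S).

Lemma cseq_ext x y : cseq x =1 cseq y -> x = y.
Proof.
case: x y => [x xP] [y yP] /= xy; have e : x = y by apply: funext.
by subst; congr CauchySeq; exact: Prop_irrelevance.
Qed.

Lemma cseq_bounded x : exists2 B, 0 < B & forall n, pnorm (x n) <= B.
Proof.
have [N NP] := cseqP x ltr01.
(* The sum dominates each of the first [N] terms; the last two summands cover the tail, and the 1
   keeps the bound positive, so that [cseq_mul] can divide by it. *)
exists (\sum_(i < N) pnorm (x i) + pnorm (x N) + 1).
  by rewrite ltr_wpDl // addr_ge0 ?pnorm_ge0 ?sumr_ge0 // => i _; exact: pnorm_ge0.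
move=> n; have [Nn|nN] := leqP N n.
  rewrite -addrA ler_wpDl ?sumr_ge0 //; first by move=> i _; exact: pnorm_ge0.
  rewrite addrC -lerBlDr (le_trans (ler_norm _)) // (le_trans (pnorm_dist _ _)) //.
  by rewrite ltW // NP.
rewrite (bigD1 (Ordinal nN)) //= -!addrA ler_wpDr //.
by rewrite !addr_ge0 ?pnorm_ge0 ?sumr_ge0 // => i _; exact: pnorm_ge0.
Qed.

Program Definition cseq_cst (a : P) : S := @CauchySeq R P (fun=> a) _.
Next Obligation. by move=> a e e0; exists 0 => *; rewrite subrr pnorm0. Qed.

Program Definition cseq_add x y : S := @CauchySeq R P (fun n => x n + y n) _.
Next Obligation.
move=> x y e e0; have e2 : 0 < e / 2 by rewrite divr_gt0.
have [N NP] := cseqP x e2; have [M MP] := cseqP y e2.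
exists (maxn N M) => m n; rewrite !geq_max => /andP[Nm Mm] /andP[Nn Mn].
rewrite opprD addrACA (le_lt_trans (pnormD _ _)) // (splitr e).
by rewrite ltrD ?NP ?MP.
Qed.

Program Definition cseq_scale (a : C) x : S :=
  @CauchySeq R P (fun n => a *: x n) _.
Next Obligation.
move=> a x e e0; have a1 : 0 < Normc.normc a + 1 by rewrite ltr_wpDl ?normc_ge0.
have [N NP] := cseqP x (divr_gt0 e0 a1).
exists N => m n Nm Nn; rewrite -scalerBr pnormZ.
have := NP m n Nm Nn; rewrite ltr_pdivlMr // mulrC; apply: le_lt_trans.
by rewrite ler_wpM2r ?pnorm_ge0 // lerDl.
Qed.

Program Definition cseq_mul x y : S := @CauchySeq R P (fun n => x n * y n) _.
Next Obligation.
move=> x y e e0; have [B B0 xB] := cseq_bounded x.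
have [D D0 yD] := cseq_bounded y.
have eB : 0 < e / 2 / B by rewrite !divr_gt0.
have eD : 0 < e / 2 / D by rewrite !divr_gt0.
have [N NP] := cseqP x eD; have [M MP] := cseqP y eB.
exists (maxn N M) => m n; rewrite !geq_max => /andP[Nm Mm] /andP[Nn Mn].
have -> : x m * y m - x n * y n = x m * (y m - y n) + (x m - x n) * y n.
  by rewrite mulrBr mulrBl addrA subrK.
rewrite (le_lt_trans (pnormD _ _)) // (splitr e) ltrD //.
  rewrite (le_lt_trans (pnormM _ _)) //.
  rewrite (@le_lt_trans _ _ (B * pnorm (y m - y n))) ?ler_wpM2r ?pnorm_ge0 //.
  by rewrite mulrC -ltr_pdivlMr // MP.
rewrite (le_lt_trans (pnormM _ _)) //.
rewrite (@le_lt_trans _ _ (pnorm (x m - x n) * D)) ?ler_wpM2l ?pnorm_ge0 //.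
by rewrite -ltr_pdivlMr // NP.
Qed.

Program Definition cseq_star x : S := @CauchySeq R P (fun n => pstar (x n)) _.
Next Obligation.
move=> x e e0; have [N NP] := cseqP x e0.
by exists N => m n Nm Nn; rewrite -pstarB pnorm_pstar NP.
Qed.

HB.instance Definition _ := gen_eqMixin S.
HB.instance Definition _ := gen_choiceMixin S.

Let cseq_addA : associative cseq_add.
Proof. by move=> x y z; apply: cseq_ext => n /=; rewrite addrA. Qed.
Let cseq_addC : commutative cseq_add.
Proof. by move=> x y; apply: cseq_ext => n /=; rewrite addrC. Qed.
Let cseq_add0 : left_id (cseq_cst 0) cseq_add.
Proof. by move=> x; apply: cseq_ext => n /=; rewrite add0r. Qed.
Let cseq_addN : left_inverse (cseq_cst 0) (cseq_scale (-1)) cseq_add.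
Proof. by move=> x; apply: cseq_ext => n /=; rewrite scaleN1r addNr. Qed.

HB.instance Definition _ :=
  GRing.isZmodule.Build S cseq_addA cseq_addC cseq_add0 cseq_addN.

Let cseq_mulA : associative cseq_mul.
Proof. by move=> x y z; apply: cseq_ext => n /=; rewrite mulrA. Qed.
Let cseq_mul1l : left_id (cseq_cst 1) cseq_mul.
Proof. by move=> x; apply: cseq_ext => n /=; rewrite mul1r. Qed.
Let cseq_mul1r : right_id (cseq_cst 1) cseq_mul.
Proof. by move=> x; apply: cseq_ext => n /=; rewrite mulr1. Qed.
Let cseq_mulDl : left_distributive cseq_mul cseq_add.
Proof. by move=> x y z; apply: cseq_ext => n /=; rewrite mulrDl. Qed.
Let cseq_mulDr : right_distributive cseq_mul cseq_add.
Proof. by move=> x y z; apply: cseq_ext => n /=; rewrite mulrDr. Qed.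
Let cseq_one_neq0 : cseq_cst 1 != cseq_cst 0 :> S.
Proof.
by apply/eqP => /(congr1 (fun x : S => x 0)) /= /eqP; rewrite oner_eq0.
Qed.

HB.instance Definition _ := GRing.Zmodule_isNzRing.Build S
  cseq_mulA cseq_mul1l cseq_mul1r cseq_mulDl cseq_mulDr cseq_one_neq0.

Let cseq_scaleA (a b : C) x : cseq_scale a (cseq_scale b x) = cseq_scale (a * b) x.
Proof. by apply: cseq_ext => n /=; rewrite scalerA. Qed.
Let cseq_scale1 : left_id 1 cseq_scale.
Proof. by move=> x; apply: cseq_ext => n /=; rewrite scale1r. Qed.
Let cseq_scaleDr : right_distributive cseq_scale +%R.
Proof. by move=> a x y; apply: cseq_ext => n /=; rewrite scalerDr. Qed.
Let cseq_scaleDl x : {morph cseq_scale^~ x : a b / a + b}.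
Proof. by move=> a b; apply: cseq_ext => n /=; rewrite scalerDl. Qed.

HB.instance Definition _ := GRing.Zmodule_isLmodule.Build C S
  cseq_scaleA cseq_scale1 cseq_scaleDr cseq_scaleDl.

Let cseq_scaleAl (a : C) x y : a *: (x * y) = a *: x * y.
Proof. by apply: cseq_ext => n /=; rewrite scalerAl. Qed.
Let cseq_scaleAr (a : C) x y : a *: (x * y) = x * (a *: y).
Proof. by apply: cseq_ext => n /=; rewrite scalerAr. Qed.

HB.instance Definition _ := GRing.Lmodule_isLalgebra.Build C S cseq_scaleAl.
HB.instance Definition _ := GRing.Lalgebra_isAlgebra.Build C S cseq_scaleAr.

Definition lnorm x : R := limn (fun n => pnorm (x n)).

Lemma lnorm_cvg x : pnorm (x n) @[n --> \oo] --> lnorm x.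
Proof.
apply: cauchy_cvgn => e /(cseqP x)[N NP]; exists N => m n Nm Nn.
exact: le_lt_trans (pnorm_dist _ _) (NP _ _ Nm Nn).
Qed.

Lemma lnormE x l : pnorm (x n) @[n --> \oo] --> l -> lnorm x = l.
Proof. exact: cvg_lim. Qed.

Lemma lnorm_ge0 x : 0 <= lnorm x.
Proof.
apply: limr_ge; first exact: cvgP (@lnorm_cvg x).
by near=> n; exact: pnorm_ge0.
Unshelve. all: by end_near.
Qed.

Lemma lnormD x y : lnorm (x + y) <= lnorm x + lnorm y.
Proof.
apply: (ler_cvg_to (@lnorm_cvg _) (cvgD (@lnorm_cvg x) (@lnorm_cvg y))).
by near=> n; exact: pnormD.
Unshelve. all: by end_near.
Qed.

Lemma lnormM x y : lnorm (x * y) <= lnorm x * lnorm y.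
Proof.
apply: (ler_cvg_to (@lnorm_cvg _) (cvgM (@lnorm_cvg x) (@lnorm_cvg y))).
by near=> n; exact: pnormM.
Unshelve. all: by end_near.
Qed.

Lemma lnormZ a x : lnorm (a *: x) = Normc.normc a * lnorm x.
Proof.
apply: lnormE; under eq_fun do rewrite [cseq _ _]/(a *: x _) pnormZ.
exact: cvgMl_tmp (@lnorm_cvg x).
Qed.

Lemma lnorm_star x : lnorm (cseq_star x * x) = lnorm x ^+ 2.
Proof.
apply: lnormE.
under eq_fun do rewrite [cseq _ _]/(pstar (x _) * x _) pnorm_star.
by apply: cvgM; exact: lnorm_cvg.
Qed.

Lemma Re_state_cvg x :
  complex.Re (pstate P (x n)) @[n --> \oo] -->
  limn (fun n => complex.Re (pstate P (x n))).
Proof.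
apply: cauchy_cvgn => e /(cseqP x)[N NP]; exists N => m n Nm Nn.
rewrite -raddfB (le_lt_trans (Re_le_normc _)) //.
exact: le_lt_trans (pstate_dist _ _) (NP _ _ Nm Nn).
Qed.

Lemma Im_state_cvg x :
  complex.Im (pstate P (x n)) @[n --> \oo] -->
  limn (fun n => complex.Im (pstate P (x n))).
Proof.
apply: cauchy_cvgn => e /(cseqP x)[N NP]; exists N => m n Nm Nn.
rewrite -raddfB (le_lt_trans (Im_le_normc _)) //.
exact: le_lt_trans (pstate_dist _ _) (NP _ _ Nm Nn).
Qed.

Definition lstate x : C :=
  Complex (limn (fun n => complex.Re (pstate P (x n))))
          (limn (fun n => complex.Im (pstate P (x n)))).

Lemma lstateE x a b :
  complex.Re (pstate P (x n)) @[n --> \oo] --> a ->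
  complex.Im (pstate P (x n)) @[n --> \oo] --> b -> lstate x = Complex a b.
Proof. by move=> xa xb; rewrite /lstate (cvg_lim _ xa) ?(cvg_lim _ xb). Qed.

Lemma lstate_scalar : scalar lstate.
Proof.
move=> [a b] x y; have [xr xi] := (@Re_state_cvg x, @Im_state_cvg x).
have [yr yi] := (@Re_state_cvg y, @Im_state_cvg y).
rewrite {2 3}/lstate; simpc; apply: lstateE.
  under eq_fun do rewrite [cseq _ _]/(_ *: x _ + y _) linearP ReD ReM /=.
  by apply: cvgD yr; apply: cvgB; exact: cvgMl_tmp.
under eq_fun do rewrite [cseq _ _]/(_ *: x _ + y _) linearP ImD ImM /=.
by apply: cvgD yi; apply: cvgD; exact: cvgMl_tmp.
Qed.

HB.instance Definition _ := GRing.isLinear.Build C S C *%R lstate lstate_scalar.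

Lemma lstate_cst (a : P) : lstate (cseq_cst a) = pstate P a.
Proof.
rewrite (@lstateE _ (complex.Re (pstate P a)) (complex.Im (pstate P a))).
- exact: complex_eta.
- by rewrite /=; apply: cvg_cst.
- by rewrite /=; apply: cvg_cst.
Qed.

Lemma lstate1 : lstate 1 = 1.
Proof. exact: etrans (lstate_cst 1) (pstate1 P). Qed.

Lemma lstate_ge0 x : 0 <= lstate (cseq_star x * x).
Proof.
set w := cseq_star x * x.
have pos n : 0 <= pstate P (w n) by exact: pstate_ge0.
have Im0 : limn (fun n => complex.Im (pstate P (w n))) = 0.
  rewrite (_ : (fun n => _) = fun=> 0) ?lim_cst //; apply: funext => n.
  exact: ger0_Im (pos n).
have Re0 : 0 <= limn (fun n => complex.Re (pstate P (w n))).
  apply: limr_ge; first exact: cvgP (@Re_state_cvg w).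
  by near=> n; exact: Re_ge0 (pos n).
by rewrite /lstate Im0 ler0c.
Unshelve. all: by end_near.
Qed.

Lemma lstate_le x : Normc.normc (lstate x) <= lnorm x.
Proof.
rewrite -[leRHS]ger0_norm ?lnorm_ge0 // -sqrtr_sqr /lstate /Normc.normc.
rewrite ler_sqrt ?sqr_ge0 //.
have [xr xi] := (@Re_state_cvg x, @Im_state_cvg x).
rewrite !expr2; apply: (ler_cvg_to (cvgD (cvgM xr xr) (cvgM xi xi))
  (cvgM (@lnorm_cvg x) (@lnorm_cvg x))).
near=> n; have := pstate_le (x n).
rewrite -(ler_pXn2r (n := 2)) ?nnegrE ?normc_ge0 ?pnorm_ge0 //.
by rewrite sqr_normcE expr2 mulJ_Re.
Unshelve. all: by end_near.
Qed.

Lemma cseq_starD x y : cseq_star (x + y) = cseq_star x + cseq_star y.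
Proof. by apply: cseq_ext => n /=; rewrite pstarD. Qed.
Lemma cseq_starZ a x : cseq_star (a *: x) = a^*%C *: cseq_star x.
Proof. by apply: cseq_ext => n /=; rewrite pstarZ. Qed.
Lemma cseq_starM x y : cseq_star (x * y) = cseq_star y * cseq_star x.
Proof. by apply: cseq_ext => n /=; rewrite pstarM. Qed.
Lemma cseq_starK x : cseq_star (cseq_star x) = x.
Proof. by apply: cseq_ext => n /=; rewrite pstarK. Qed.

Definition seq_preCstar : preCstar R :=
  @PreCstar R S cseq_star lnorm cseq_starD cseq_starZ cseq_starM cseq_starK
    lnorm_ge0 lnormD lnormZ lnormM lnorm_star lstate lstate1 lstate_ge0 lstate_le.

Lemma lnorm_cst (a : P) : lnorm (cseq_cst a) = pnorm a.
Proof. by apply: lnormE; rewrite /=; apply: cvg_cst. Qed.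

(** Density of the constant sequences, with the terms of [x] as approximants. *)
Lemma lnorm_tail x e : 0 < e ->
  exists N, forall n, (N <= n)%N -> lnorm (x - cseq_cst (x n)) < e.
Proof.
move=> e0; have e2 : 0 < e / 2 by rewrite divr_gt0.
have [N NP] := cseqP x e2; exists N => n Nn.
(* A limit preserves only the weak inequality, hence the detour through e / 2. *)
rewrite (@le_lt_trans _ _ (e / 2)) ?ltr_pdivrMr ?ltr_pMr ?ltr1n //.
apply: limr_le; first exact: cvgP (@lnorm_cvg _).
near=> m; rewrite [cseq _ _]/(x m + (-1) *: x n) scaleN1r ltW // NP //.
by near: m; exists N.
Unshelve. all: by end_near.
Qed.

End CauchySeqs.

Definition pcomplete (R : realType) (P : preCstar R) :=
  forall u : nat -> P,
    (forall e, 0 < e -> exists N, forall m n, (N <= m)%N -> (N <= n)%N ->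
       pnorm (u m - u n) < e) ->
    exists l, forall e, 0 < e -> exists N, forall n, (N <= n)%N ->
       pnorm (u n - l) < e.

(** Diagonal argument: replace the n-th sequence [u n] by a constant [y n] within 1 / (n + 1) of it.
    The [y n] form a Cauchy sequence in [P], which is itself the limit. *)
Lemma seq_preCstar_complete (R : realType) (P : preCstar R) :
  pcomplete (seq_preCstar P).
Proof.
move=> u uC; pose d n : R := n.+1%:R^-1.
have d0 n : 0 < d n by rewrite invr_gt0.
have dP e : 0 < e -> exists N, forall n, (N <= n)%N -> d n < e.
  move=> e0; have [N NP] := ltr_add_invr e0; exists N => n Nn.
  rewrite add0r in NP; apply: le_lt_trans NP.
  by rewrite lef_pV2 ?posrE // ler_nat ltnS.
have /choice[y yP] n : exists a : P, lnorm (u n - cseq_cst a) < d n.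
  by have [N NP] := @lnorm_tail _ _ (u n) _ (d0 n); exists (u n N); apply: NP.
have distE (a b : P) : pnorm (a - b) = lnorm (cseq_cst a - cseq_cst b).
  by rewrite -lnorm_cst; congr lnorm; apply: cseq_ext => n /=; rewrite scaleN1r.
have split3 (a b c : cauchySeq P) : lnorm (a - c) <= lnorm (a - b) + lnorm (b - c).
  exact: (@pnorm_split _ (seq_preCstar P)).
have yC e : 0 < e -> exists N, forall m n, (N <= m)%N -> (N <= n)%N ->
    pnorm (y m - y n) < e.
  move=> e0; have e3 : 0 < e / 3 by rewrite divr_gt0.
  have [N NP] := dP _ e3; have [M MP] := uC _ e3.
  exists (maxn N M) => m n; rewrite !geq_max => /andP[Nm Mm] /andP[Nn Mn].
  have h1 := lt_trans (yP m) (NP _ Nm); have h2 := lt_trans (yP n) (NP _ Nn).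
  have h3 := MP m n Mm Mn; rewrite -[pnorm _]/(lnorm _) in h3.
  have h4 := split3 (cseq_cst (y m)) (u m) (cseq_cst (y n)).
  have h5 := split3 (u m) (u n) (cseq_cst (y n)).
  have h6 : lnorm (cseq_cst (y m) - u m) = lnorm (u m - cseq_cst (y m)).
    exact: (@pnormBC _ (seq_preCstar P)).
  rewrite distE; lra.
exists (CauchySeq yC) => e e0; have e2 : 0 < e / 2 by rewrite divr_gt0.
have [N NP] := dP _ e2; have [M MP] := @lnorm_tail _ _ (CauchySeq yC) _ e2.
exists (maxn N M) => n; rewrite !geq_max => /andP[Nn Mn].
have h1 := lt_trans (yP n) (NP _ Nn); have h2 := MP n Mn.
have h3 := split3 (u n) (cseq_cst (y n)) (CauchySeq yC).
have h4 : lnorm (cseq_cst (y n) - CauchySeq yC) = lnorm (CauchySeq yC - cseq_cst (y n)).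
  exact: (@pnormBC _ (seq_preCstar P)).
rewrite -[pnorm _]/(lnorm _); lra.
Qed.

(** * Quotient by the elements of seminorm zero *)

Section Separation.
Local Open Scope quotient_scope.
Variables (R : realType) (P : preCstar R).
Local Notation C := R[i].
Implicit Types (x y z : P).

Definition null_equiv x y := pnorm (x - y) == 0.

Lemma null_equiv_refl : reflexive null_equiv.
Proof. by move=> x; rewrite /null_equiv subrr pnorm0. Qed.

Lemma null_equiv_sym : symmetric null_equiv.
Proof. by move=> x y; rewrite /null_equiv pnormBC. Qed.

Lemma null_equiv_trans : transitive null_equiv.
Proof.
move=> y x z /eqP xy /eqP yz; rewrite /null_equiv eq_le pnorm_ge0 andbT.
by rewrite (le_trans (pnorm_split x y z)) // xy yz addr0.
Qed.

Canonical null_equivalence :=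
  EquivRel null_equiv null_equiv_refl null_equiv_sym null_equiv_trans.

Definition sepquot := {eq_quot null_equivalence}.

HB.instance Definition _ := Choice.on sepquot.

Definition cls (x : P) : sepquot := \pi_({eq_quot null_equivalence}) x.

Lemma clsP x y : cls x = cls y <-> pnorm (x - y) = 0.
Proof. by split=> [/eqmodP /eqP|/eqP xy] //; apply/eqmodP. Qed.

End Separation.

Section SeparatedAlgebra.
Variables (R : realType) (P : preCstar R).
Local Notation C := R[i].
Local Notation Q := (sepquot P).
Implicit Types (x y z : P) (p q r : Q).

Definition crepr q : P := repr q.

Lemma creprK q : cls (crepr q) = q. Proof. exact: reprK. Qed.

Lemma crepr_cls x : pnorm (crepr (cls x) - x) = 0.
Proof. by apply/clsP; rewrite creprK. Qed.

Lemma crepr_cls_le x : pnorm (crepr (cls x)) = pnorm x.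
Proof.
apply/eqP; rewrite -subr_eq0 -normr_le0.
by rewrite (le_trans (pnorm_dist _ _)) // crepr_cls.
Qed.

Lemma clsW (A : Q -> Prop) : (forall x, A (cls x)) -> forall q, A q.
Proof. by move=> Acls q; rewrite -[q]creprK. Qed.

Lemma cls_eq x y : pnorm (x - y) <= 0 -> cls x = cls y.
Proof. by move=> h; apply/clsP/eqP; rewrite eq_le h pnorm_ge0. Qed.

(** The operations act on chosen representatives; [qaddE] and its companions show that another
    choice changes the result only by an element of seminorm zero. *)
Definition qadd p q : Q := cls (crepr p + crepr q).
Definition qscale (a : C) q : Q := cls (a *: crepr q).
Definition qmul p q : Q := cls (crepr p * crepr q).
Definition qstar q : Q := cls (pstar (crepr q)).
Definition qnorm q : R := pnorm (crepr q).

Lemma qaddE x y : qadd (cls x) (cls y) = cls (x + y).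
Proof.
apply: cls_eq; rewrite opprD addrACA (le_trans (pnormD _ _)) //.
by rewrite !crepr_cls addr0.
Qed.

Lemma qscaleE a x : qscale a (cls x) = cls (a *: x).
Proof. by apply: cls_eq; rewrite -scalerBr pnormZ crepr_cls mulr0. Qed.

Lemma qmulE x y : qmul (cls x) (cls y) = cls (x * y).
Proof.
apply: cls_eq; set u := crepr _; set v := crepr _.
have -> : u * v - x * y = u * (v - y) + (u - x) * y.
  by rewrite mulrBr mulrBl addrA subrK.
rewrite (le_trans (pnormD _ _)) // -[leRHS]addr0 lerD //.
  by rewrite (le_trans (pnormM _ _)) // crepr_cls mulr0.
by rewrite (le_trans (pnormM _ _)) // crepr_cls mul0r.
Qed.

Lemma qstarE x : qstar (cls x) = cls (pstar x).
Proof. by apply: cls_eq; rewrite -pstarB pnorm_pstar crepr_cls. Qed.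

Lemma qnormE x : qnorm (cls x) = pnorm x.
Proof. exact: crepr_cls_le. Qed.

Let qaddA : associative qadd.
Proof. by elim/clsW => x; elim/clsW => y; elim/clsW => z; rewrite !qaddE addrA. Qed.
Let qaddC : commutative qadd.
Proof. by elim/clsW => x; elim/clsW => y; rewrite !qaddE addrC. Qed.
Let qadd0 : left_id (cls 0) qadd.
Proof. by elim/clsW => x; rewrite qaddE add0r. Qed.
Let qaddN : left_inverse (cls 0) (qscale (-1)) qadd.
Proof. by elim/clsW => x; rewrite qscaleE qaddE scaleN1r addNr. Qed.

HB.instance Definition _ := GRing.isZmodule.Build Q qaddA qaddC qadd0 qaddN.

Lemma clsD x y : cls (x + y) = cls x + cls y.
Proof. by rewrite -qaddE. Qed.

Let qmulA : associative qmul.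
Proof. by elim/clsW => x; elim/clsW => y; elim/clsW => z; rewrite !qmulE mulrA. Qed.
Let qmul1l : left_id (cls 1) qmul.
Proof. by elim/clsW => x; rewrite qmulE mul1r. Qed.
Let qmul1r : right_id (cls 1) qmul.
Proof. by elim/clsW => x; rewrite qmulE mulr1. Qed.
Let qmulDl : left_distributive qmul +%R.
Proof.
by elim/clsW => x; elim/clsW => y; elim/clsW => z; rewrite -clsD !qmulE mulrDl clsD.
Qed.

Let qmulDr : right_distributive qmul +%R.
Proof.
by elim/clsW => x; elim/clsW => y; elim/clsW => z; rewrite -clsD !qmulE mulrDr clsD.
Qed.

Let qone_neq0 : cls 1 != 0 :> Q.
Proof.
apply/eqP => /clsP; rewrite subr0 => n1.
(* The state takes the value 1 at the unit and is contractive, so the unit is not null. *)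
have := pstate_le (1 : P); rewrite pstate1 Normc.normc1 n1.
by rewrite leNgt ltr01.
Qed.

HB.instance Definition _ := GRing.Zmodule_isNzRing.Build Q
  qmulA qmul1l qmul1r qmulDl qmulDr qone_neq0.

Lemma clsM x y : cls (x * y) = cls x * cls y.
Proof. by rewrite -qmulE. Qed.

Let qscaleA (a b : C) q : qscale a (qscale b q) = qscale (a * b) q.
Proof. by elim/clsW: q => x; rewrite !qscaleE scalerA. Qed.
Let qscale1 : left_id 1 qscale.
Proof. by elim/clsW => x; rewrite !qscaleE scale1r. Qed.
Let qscaleDr : right_distributive qscale +%R.
Proof.
by move=> a; elim/clsW => x; elim/clsW => y; rewrite -clsD !qscaleE scalerDr clsD.
Qed.

Let qscaleDl q : {morph qscale^~ q : a b / a + b}.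
Proof. by elim/clsW: q => x a b; rewrite !qscaleE scalerDl clsD. Qed.

HB.instance Definition _ := GRing.Zmodule_isLmodule.Build C Q
  qscaleA qscale1 qscaleDr qscaleDl.

Lemma clsZ a x : cls (a *: x) = a *: cls x.
Proof. by rewrite -qscaleE. Qed.

Let qscaleAl (a : C) p q : a *: (p * q) = a *: p * q.
Proof. by elim/clsW: p => x; elim/clsW: q => y; rewrite -clsM -!clsZ -clsM scalerAl. Qed.
Let qscaleAr (a : C) p q : a *: (p * q) = p * (a *: q).
Proof. by elim/clsW: p => x; elim/clsW: q => y; rewrite -clsM -!clsZ -clsM scalerAr. Qed.

HB.instance Definition _ := GRing.Lmodule_isLalgebra.Build C Q qscaleAl.
HB.instance Definition _ := GRing.Lalgebra_isAlgebra.Build C Q qscaleAr.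

Lemma clsB x y : cls (x - y) = cls x - cls y.
Proof. by rewrite -scaleN1r clsD clsZ scaleN1r. Qed.

Hypothesis complete : pcomplete P.

Let qstarD p q : qstar (p + q) = qstar p + qstar q.
Proof.
by elim/clsW: p => x; elim/clsW: q => y; rewrite -clsD !qstarE pstarD clsD.
Qed.

Let qstarZ a q : qstar (a *: q) = a^*%C *: qstar q.
Proof. by elim/clsW: q => x; rewrite -clsZ !qstarE pstarZ clsZ. Qed.
Let qstarM p q : qstar (p * q) = qstar q * qstar p.
Proof.
by elim/clsW: p => x; elim/clsW: q => y; rewrite -clsM !qstarE pstarM clsM.
Qed.

Let qstarK q : qstar (qstar q) = q.
Proof. by elim/clsW: q => x; rewrite !qstarE pstarK. Qed.
Let qnorm_eq0 q : qnorm q = 0 -> q = 0.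
Proof.
by elim/clsW: q => x; rewrite qnormE => x0; apply/clsP; rewrite subr0.
Qed.

Let qnormD p q : qnorm (p + q) <= qnorm p + qnorm q.
Proof.
by elim/clsW: p => x; elim/clsW: q => y; rewrite -clsD !qnormE pnormD.
Qed.

Let qnormZ a q : qnorm (a *: q) = Normc.normc a * qnorm q.
Proof. by elim/clsW: q => x; rewrite -clsZ !qnormE pnormZ. Qed.
Let qnormM p q : qnorm (p * q) <= qnorm p * qnorm q.
Proof.
by elim/clsW: p => x; elim/clsW: q => y; rewrite -clsM !qnormE pnormM.
Qed.

Let qnorm_star q : qnorm (qstar q * q) = qnorm q ^+ 2.
Proof. by elim/clsW: q => x; rewrite qstarE -clsM !qnormE pnorm_star. Qed.
Let qnorm_complete (u : nat -> Q) :
  (forall e : R, 0 < e -> exists N : nat, forall m n : nat,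
     (N <= m)%N -> (N <= n)%N -> qnorm (u m - u n) < e) ->
  exists l : Q, forall e : R, 0 < e -> exists N : nat, forall n : nat,
     (N <= n)%N -> qnorm (u n - l) < e.
Proof.
move=> uC; have uE n : u n = cls (crepr (u n)) by rewrite creprK.
have [e /uC[N NP]|l lP] := complete (u := fun n => crepr (u n)).
  exists N => m n Nm Nn; have := NP m n Nm Nn.
  by rewrite (uE m) (uE n) -clsB qnormE -!uE.
exists (cls l) => e /lP[N NP]; exists N => n /NP.
by rewrite [in X in _ -> X](uE n) -clsB qnormE.
Qed.

Definition separated_isCstar := Algebra_isCstarAlgebra.Build R Q
  qstarD qstarZ qstarM qstarK qnorm_eq0 qnormD qnormZ qnormM qnorm_star
  qnorm_complete.

Definition separated_Cstar : cstarAlgType R := HB.pack Q separated_isCstar.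

Definition qstate q : C := pstate P (crepr q).

Lemma qstateE x : qstate (cls x) = pstate P x.
Proof.
apply/eqP; rewrite -subr_eq0; apply/eqP/Normc.eq0_normc/eqP.
by rewrite eq_le normc_ge0 andbT (le_trans (pstate_dist _ _)) // crepr_cls.
Qed.

Let qstate_scalar : scalar qstate.
Proof.
move=> a; elim/clsW => x; elim/clsW => y.
by rewrite -clsZ -clsD !qstateE linearP.
Qed.

HB.instance Definition _ := GRing.isLinear.Build C Q C *%R qstate qstate_scalar.

Lemma preCstar_realization (I : Type) (X : I -> P) :
  (forall i, pstar (X i) = X i) ->
  exists (A : cstarAlgType R) (phi : {scalar A}) (x : I -> A),
    [/\ phi 1 = 1, forall a : A, 0 <= phi (star a * a),
        forall i, star (x i) = x i
      & forall w : seq I, phi (\prod_(i <- w) x i) = pstate P (\prod_(i <- w) X i)].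
Proof.
move=> Xsa; pose phi : {scalar separated_Cstar} := qstate.
exists separated_Cstar, phi, (fun i => cls (X i)); split.
- by rewrite /phi -[LHS]/(qstate (cls 1)) qstateE pstate1.
- elim/clsW => x; rewrite -[star _ * _]/(qstar (cls x) * cls x).
  by rewrite qstarE -clsM [phi _]qstateE pstate_ge0.
- by move=> i; rewrite -[LHS]/(qstar _) qstarE Xsa.
move=> w; rewrite -qstateE; congr qstate.
by elim: w => [|i w IH]; rewrite ?big_nil // !big_cons IH clsM.
Qed.

End SeparatedAlgebra.

(** Reduces positivity of a distribution to finding bounded operators with [op_star (Y i) = Y i];
    they enter the completion as constant sequences, on which the limit state is the vacuum
    state. *)
Theorem preHilbert_realization (R : realType) (H : preHilbert R) (I : Type)
    (Y : I -> boundedOp H) : (forall i, op_star (Y i) = Y i) ->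
  exists (A : cstarAlgType R) (phi : {scalar A}) (x : I -> A),
    [/\ phi 1 = 1, forall a : A, 0 <= phi (star a * a),
        forall i, star (x i) = x i
      & forall w : seq I, phi (\prod_(i <- w) x i) =
          ip (ph_vac H) (foldr (fun i => Y i) (ph_vac H) w)].
Proof.
move=> Ysa; pose X i : seq_preCstar (op_preCstar H) := cseq_cst (P := op_preCstar H) (Y i).
have Xsa i : pstar (X i) = X i.
  by apply: cseq_ext => n; rewrite /= [LHS]Ysa.
have [A [phi [x [phi1 phi_ge0 xsa xE]]]] :=
  preCstar_realization (@seq_preCstar_complete _ (op_preCstar H)) Xsa.
exists A, phi, x; split=> // w; rewrite xE.
have -> : \prod_(i <- w) X i = cseq_cst (P := op_preCstar H) (\prod_(i <- w) Y i).
  elim: w => [|i w IH]; rewrite ?big_nil // !big_cons IH.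
  by apply: cseq_ext.
rewrite -[LHS]/(lstate _) lstate_cst -[LHS]/(ip _ _); congr ip.
by elim: w => [|i w IH]; rewrite ?big_nil // big_cons /= -IH.
Qed.

(** * Positive semidefinite kernels *)

Section PsdForms.
Variables (R : realType) (V : lmodType R[i]).
Local Notation C := R[i].

Record psd_form (f : V -> V -> C) : Prop := PsdForm {
  psd_form_linear : forall x, scalar (f x);
  psd_formC : forall x y, f x y = (f y x)^*%C;
  psd_form_ge0 : forall x, 0 <= f x x
}.

End PsdForms.

Section PsdKernels.
Variables (R : realType).
Local Notation C := R[i].

(** Indices may repeat, so the notion pulls back along arbitrary maps ([psd_kernel_comp]) and needs
    no structure on [I]. *)
Definition psd_kernel (I : Type) (K : I -> I -> C) : Prop :=
  forall n (c : 'I_n -> C) (u : 'I_n -> I),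
    0 <= \sum_i \sum_j (c i)^*%C * c j * K (u i) (u j).

Lemma psd_form_kernel (V : lmodType C) (f : V -> V -> C) :
  psd_form f -> psd_kernel f.
Proof.
move=> [fl fC f0] n c u.
have fD x y z : f x (y + z) = f x y + f x z.
  by have := fl x 1 y z; rewrite scale1r mul1r.
have f0r x : f x 0 = 0.
  by have := fl x (-1) 0 0; rewrite scaler0 addr0 mulN1r addNr.
have fZ x a y : f x (a *: y) = a * f x y.
  by have := fl x a y 0; rewrite !addr0 f0r addr0.
have fsum x : f x (\sum_j c j *: u j) = \sum_j c j * f x (u j).
  rewrite (big_morph (f x) (fD x) (f0r x)).
  by apply: eq_bigr => j _; rewrite fZ.
suff -> : \sum_i \sum_j (c i)^*%C * c j * f (u i) (u j) =
    f (\sum_i c i *: u i) (\sum_j c j *: u j) by exact: f0.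
rewrite fsum exchange_big /=; apply: eq_bigr => j _.
rewrite [in RHS]fC fsum rmorph_sum mulr_sumr /=; apply: eq_bigr => i _.
by rewrite rmorphM /= -fC mulrCA mulrA mulrAC mulrC mulrA mulrAC.
Qed.

Lemma conjCE (z : C) : Num.conj z = z^*%C.
Proof. by []. Qed.

(** The spectral theorem in entries. The first identity writes the matrix as a combination of
    rank-one ones; the second, the diagonal of the conjugated matrix, gives the sign of the
    eigenvalues [d] for a positive semidefinite matrix. *)
Lemma hermitian_decomposition n (M : 'M[C]_n) :
  (forall i j, M i j = (M j i)^*%C) ->
  exists (P : 'M[C]_n) (d : 'I_n -> C),
    (forall i j, M i j = \sum_k d k * ((P k i)^*%C * P k j)) /\
    (forall k, d k = \sum_i \sum_j P k i * (P k j)^*%C * M i j).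
Proof.
move=> Mherm; pose adj (B : 'M[C]_n) := map_mx Num.conj B^T.
have Madj : adj M = M by apply/matrixP => i j; rewrite !mxE [RHS]Mherm.
have /orthomx_spectralP : M \is normalmx by apply/normalmxP; rewrite -/(adj M) Madj.
have Punitary := spectral_unitarymx M.
set P := spectralmx M in Punitary *; set D := spectral_diag M.
rewrite invmx_unitary // => ME; exists P, (D 0); split=> [i j|k].
  rewrite [in LHS]ME mul_mx_diag mxE; apply: eq_bigr => k _.
  by rewrite !mxE conjCE; ring.
have PM : P *m M *m adj P = diag_mx D.
  have PP : P *m adj P = 1%:M by exact/unitarymxP.
  by rewrite ME -/(adj P) !mulmxA PP mul1mx -mulmxA PP mulmx1.
have := congr1 (fun B : 'M_n => B k k) PM; rewrite !mxE eqxx mulr1n => <-.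
rewrite exchange_big /=; apply: eq_bigr => j _.
rewrite !mxE mulr_suml; apply: eq_bigr => i _.
by rewrite conjCE; ring.
Qed.

(** Schur product theorem: diagonalising the Gram matrix of [f] turns the product into a sum of
    copies of [K], reweighted by the rows of [P], with nonnegative coefficients [d]. *)
Lemma psd_schur (I : Type) (V : lmodType C) (f : V -> V -> C) (h : I -> V)
    (K : I -> I -> C) :
  psd_form f -> psd_kernel K -> psd_kernel (fun u v => f (h u) (h v) * K u v).
Proof.
move=> fpsd Kpsd n c u.
pose M : 'M[C]_n := \matrix_(i, j) f (h (u i)) (h (u j)).
have [|P [d [ME dE]]] := @hermitian_decomposition _ M.
  by move=> i j; rewrite !mxE (psd_formC fpsd).
have d0 k : 0 <= d k.
  rewrite dE; have := psd_form_kernel fpsd (fun i => (P k i)^*%C) (h \o u).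
  congr (0 <= _); apply: eq_bigr => i _; apply: eq_bigr => j _.
  by rewrite conjcK mxE.
suff -> : \sum_i \sum_j (c i)^*%C * c j * (f (h (u i)) (h (u j)) * K (u i) (u j)) =
    \sum_k d k * \sum_i \sum_j (c i * P k i)^*%C * (c j * P k j) * K (u i) (u j).
  by apply: sumr_ge0 => k _; rewrite mulr_ge0.
under [RHS]eq_bigr do rewrite mulr_sumr.
rewrite [RHS]exchange_big; apply: eq_bigr => i _ /=.
under [RHS]eq_bigr do rewrite mulr_sumr.
rewrite [RHS]exchange_big; apply: eq_bigr => j _ /=.
have := ME i j; rewrite mxE => ->; rewrite mulr_suml mulr_sumr.
by apply: eq_bigr => k _; rewrite rmorphM /=; ring.
Qed.

Lemma psd_kernelD (I : Type) (K L : I -> I -> C) :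
  psd_kernel K -> psd_kernel L -> psd_kernel (fun u v => K u v + L u v).
Proof.
move=> Kp Lp n c u; rewrite (_ : \sum_i _ =
  \sum_i \sum_j (c i)^*%C * c j * K (u i) (u j) +
  \sum_i \sum_j (c i)^*%C * c j * L (u i) (u j)) ?addr_ge0 //.
rewrite -big_split; apply: eq_bigr => i _.
by rewrite -big_split; apply: eq_bigr => j _; rewrite mulrDr.
Qed.

Lemma psd_kernelZ (I : Type) (a : C) (K : I -> I -> C) :
  0 <= a -> psd_kernel K -> psd_kernel (fun u v => a * K u v).
Proof.
move=> a0 Kp n c u; rewrite (_ : \sum_i _ =
  a * \sum_i \sum_j (c i)^*%C * c j * K (u i) (u j)) ?mulr_ge0 //.
rewrite mulr_sumr; apply: eq_bigr => i _.
by rewrite mulr_sumr; apply: eq_bigr => j _; rewrite mulrCA.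
Qed.

Lemma psd_kernel_weight (I : Type) (a : I -> C) (K : I -> I -> C) :
  psd_kernel K -> psd_kernel (fun u v => (a u)^*%C * a v * K u v).
Proof.
move=> Kp n c u; have := Kp n (fun i => c i * a (u i)) u.
congr (0 <= _); apply: eq_bigr => i _; apply: eq_bigr => j _.
by rewrite rmorphM /=; ring.
Qed.

Lemma psd_kernel_comp (I J : Type) (h : J -> I) (K : I -> I -> C) :
  psd_kernel K -> psd_kernel (fun u v => K (h u) (h v)).
Proof. by move=> Kp n c u; exact: (Kp n c (h \o u)). Qed.

Lemma psd_kernel1 (I : Type) : psd_kernel (fun _ _ : I => 1 : C).
Proof.
move=> n c u; rewrite (_ : \sum_i _ = (\sum_i c i) * (\sum_i c i)^*%C).
  exact: mulcJ_ge0.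
rewrite rmorph_sum mulr_sumr; apply: eq_bigr => i _ /=.
by rewrite mulr_suml; apply: eq_bigr => j _; rewrite mulr1 mulrC.
Qed.

End PsdKernels.

Section PreHilbertSums.
Variables (R : realType) (H : preHilbert R).
Implicit Types (x y : H).

Lemma ip_sumr (J : Type) (r : seq J) (F : J -> H) x :
  ip x (\sum_(j <- r) F j) = \sum_(j <- r) ip x (F j).
Proof. exact: (big_morph (ip x) (ipDr x) (ip0r x)). Qed.

Lemma ip_suml (J : Type) (r : seq J) (F : J -> H) x :
  ip (\sum_(j <- r) F j) x = \sum_(j <- r) ip (F j) x.
Proof.
by apply: (big_morph (fun y => ip y x)) => [y z|]; rewrite ?ipDl ?ip0l.
Qed.

Lemma ip_malg_lin (I : choiceType) (f g : I -> H) (x y : malg I R[i]) :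
  ip (malg_lin f x) (malg_lin g y) =
  \sum_(u <- msupp x) \sum_(v <- msupp y)
     (mcoeff u x)^*%C * mcoeff v y * ip (f u) (g v).
Proof.
rewrite ip_suml; apply: eq_bigr => u _; rewrite ip_sumr; apply: eq_bigr => v _.
by rewrite ipZl ipZr mulrA.
Qed.

End PreHilbertSums.

Lemma malg_lin_id (I : choiceType) (S : comNzRingType) (x : malg I S) :
  malg_lin (fun u => mkmalgU u 1 : malg I S) x = x.
Proof. by rewrite [RHS]malg_sumU. Qed.

Record kernelSpace (R : realType) := KernelSpace {
  ks_index : choiceType;
  ks_kernel : ks_index -> ks_index -> R[i];
  ks_base : ks_index;
  ks_psd : psd_kernel ks_kernel;
  ks_herm : forall u v, ks_kernel u v = (ks_kernel v u)^*%C;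
  ks_base1 : ks_kernel ks_base ks_base = 1
}.

(** * The space with semi-inner product spanned by a kernel *)

Section KernelPreHilbert.
Variables (R : realType) (S : kernelSpace R).
Local Notation C := R[i].
Local Notation I := (ks_index S).
Local Notation K := (@ks_kernel R S).
Local Notation E := (malg I C).
Implicit Types (u v : I) (x y : E).

(** With the outer sum over the second argument, [kform x] is a linear extension from the basis, and
    its linearity is an instance of [malg_lin_is_linear]. *)
Definition kform x y : C := \sum_(v <- msupp y) mcoeff v y *
  \sum_(u <- msupp x) (mcoeff u x)^*%C * K u v.

Lemma kform_linear x : scalar (kform x).
Proof.
exact: (@malg_lin_is_linear _ _ C^o
  (fun v => \sum_(u <- msupp x) (mcoeff u x)^*%C * K u v)).
Qed.

Lemma kformE x y : kform x y = \sum_(u <- msupp x) \sum_(v <- msupp y)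
  (mcoeff u x)^*%C * mcoeff v y * K u v.
Proof.
rewrite exchange_big; apply: eq_bigr => v _; rewrite mulr_sumr.
by apply: eq_bigr => u _; rewrite mulrA [mcoeff v y * _]mulrC.
Qed.

Lemma kformC x y : kform x y = (kform y x)^*%C.
Proof.
rewrite !kformE exchange_big rmorph_sum; apply: eq_bigr => v _ /=.
rewrite rmorph_sum; apply: eq_bigr => u _ /=.
by rewrite !rmorphM /= conjcK -ks_herm; congr (_ * _); rewrite mulrC.
Qed.

Lemma psd_kernel_sum (L : I -> I -> C) (s : seq I) (c : I -> C) :
  psd_kernel L -> 0 <= \sum_(u <- s) \sum_(v <- s) (c u)^*%C * c v * L u v.
Proof.
move=> Lp; have := Lp _ (c \o tnth (in_tuple s)) (tnth (in_tuple s)).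
congr (0 <= _); rewrite [RHS]big_tnth; apply: eq_bigr => i _.
by rewrite [RHS]big_tnth; apply: eq_bigr.
Qed.

Lemma kform_ge0 x : 0 <= kform x x.
Proof. rewrite kformE; exact/psd_kernel_sum/ks_psd. Qed.

Lemma kform_basis u v : kform (mkmalgU u 1) (mkmalgU v 1) = K u v.
Proof.
rewrite kformE !msuppU oner_eq0 !big_seq_fset1 !mcoeffUU.
by rewrite rmorph1 !mul1r.
Qed.

Lemma kform_vac :
  kform (mkmalgU (ks_base S) 1) (mkmalgU (ks_base S) 1) = 1.
Proof. by rewrite kform_basis ks_base1. Qed.

Definition kernel_preHilbert : preHilbert R :=
  @PreHilbert R E kform kform_linear kformC kform_ge0 _ kform_vac.

Definition ket u : kernel_preHilbert := mkmalgU u 1.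

Lemma ip_ket u v : ip (ket u) (ket v) = K u v.
Proof. exact: kform_basis. Qed.

Lemma malg_lin_ket (V : lmodType C) (f : I -> V) u : malg_lin f (ket u) = f u.
Proof. by rewrite malg_linU scale1r. Qed.

Variables (f g : I -> kernel_preHilbert) (M : R).
Hypothesis M_ge0 : 0 <= M.
Hypothesis adjoint : forall u v, ip (f u) (ket v) = ip (ket u) (g v).
Hypothesis bounded : psd_kernel (fun u v => M%:C%C * K u v - ip (f u) (f v)).

Lemma kernel_op_adj (x y : kernel_preHilbert) :
  ip (malg_lin f x) y = ip x (malg_lin g y).
Proof.
rewrite -{1}(malg_lin_id y) -{2}(malg_lin_id x) !ip_malg_lin.
apply: eq_bigr => u _; apply: eq_bigr => v _.
by congr (_ * _); exact: adjoint.
Qed.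

(** The hypothesis [bounded] says that M minus the Gram kernel of the image vectors is positive;
    evaluated at the coefficients of [x] it compares the two squared norms. *)
Lemma kernel_op_bounded : exists c, forall x : kernel_preHilbert,
  nrm (malg_lin f x : kernel_preHilbert) <= c * nrm x.
Proof.
exists (Num.sqrt M) => x.
rewrite -(ler_pXn2r (n := 2)) ?nnegrE ?mulr_ge0 ?sqrtr_ge0 ?nrm_ge0 //.
rewrite exprMn !sqr_nrm sqr_sqrtr // -subr_ge0 -Re_realM -raddfB.
apply: Re_ge0; rewrite -{1}(malg_lin_id x) -{2}(malg_lin_id x) !ip_malg_lin.
rewrite mulr_sumr -sumrB.
have := psd_kernel_sum (msupp x) (fun u => mcoeff u x) bounded.
congr (0 <= _); apply: eq_bigr => u _; rewrite mulr_sumr -sumrB.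
apply: eq_bigr => v _; rewrite mulrBr; congr (_ - _).
by rewrite -ip_ket mulrCA.
Qed.

Definition kernel_op : boundedOp kernel_preHilbert :=
  @BoundedOp R kernel_preHilbert (malg_lin f) (malg_lin g)
    (malg_lin_is_linear f) (malg_lin_is_linear g) kernel_op_adj kernel_op_bounded.

End KernelPreHilbert.

(** * Boundedness of positive functionals *)

Section CstarFacts.
Variables (R : realType) (A : cstarAlgType R).
Local Notation C := R[i].
Implicit Types (a b h x y z : A).

Lemma star0 : star (0 : A) = 0.
Proof. by rewrite -[in LHS](scale0r (0 : A)) starZ conjc0 scale0r. Qed.

Lemma starN x : star (- x) = - star x.
Proof. by rewrite -scaleN1r starZ rmorphN1 scaleN1r. Qed.

Lemma starB x y : star (x - y) = star x - star y.
Proof. by rewrite starD starN. Qed.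

Lemma star1 : star (1 : A) = 1.
Proof. by rewrite -[RHS]starK -[in RHS](mul1r (star 1)) starM starK mul1r. Qed.

Lemma cnormN x : cnorm (- x) = cnorm x.
Proof.
rewrite -scaleN1r cnormZ -[in LHS](rmorphN1 (real_complex R)).
by rewrite normc_real normrN1 mul1r.
Qed.

Lemma cnorm0 : cnorm (0 : A) = 0.
Proof. by rewrite -[in LHS](scale0r (0 : A)) cnormZ Normc.normc0 mul0r. Qed.

Lemma cnorm_ge0 x : 0 <= cnorm x.
Proof.
have := cnormD x (- x); rewrite subrr cnorm0 cnormN; lra.
Qed.

Lemma cnormBC x y : cnorm (x - y) = cnorm (y - x).
Proof. by rewrite -opprB cnormN. Qed.

Lemma cnorm_split x y z : cnorm (x - z) <= cnorm (x - y) + cnorm (y - z).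
Proof. by rewrite (_ : x - z = (x - y) + (y - z)) ?cnormD // addrA subrK. Qed.

Lemma cnorm_starE x : cnorm (star x) = cnorm x.
Proof.
have le_star y : cnorm y <= cnorm (star y).
  have [->|y0] := eqVneq (cnorm y) 0; first exact: cnorm_ge0.
  have yp : 0 < cnorm y by rewrite lt_def y0 cnorm_ge0.
  by rewrite -(ler_pM2r yp) -expr2 -cnorm_star cnormM.
by apply/eqP; rewrite eq_le -{2}[x]starK !le_star.
Qed.

(** Turns approximate equalities along a convergent sequence into exact ones for its limit. *)
Lemma cnorm_small_eq0 x c : (forall e, 0 < e -> cnorm x <= c * e) -> x = 0.
Proof.
move=> small; apply: cnorm_eq0; apply/eqP; rewrite eq_le cnorm_ge0 andbT.
rewrite leNgt; apply/negP => xp.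
have c1 : 0 < `|c| + 1 by rewrite ltr_wpDl.
have := small (cnorm x / 2 / (`|c| + 1)) (divr_gt0 (divr_gt0 xp (ltr0n _ 2)) c1).
rewrite mulrA ler_pdivlMr //.
have := ler_norm c; nra.
Qed.

Lemma cauchy_geometric (u : nat -> A) :
  (forall n, cnorm (u n.+1 - u n) <= 2^-1 ^+ n) ->
  exists l, forall e : R, 0 < e -> exists N : nat, forall n, (N <= n)%N ->
    cnorm (u n - l) < e.
Proof.
move=> step; apply: cnorm_complete => e e0.
(* The exact value of the geometric sum, rather than its upper bound, is what the induction on [m]
   can carry. *)
have tail n m : cnorm (u (n + m)%N - u n) <= 2 * 2^-1 ^+ n - 2 * 2^-1 ^+ (n + m).
  elim: m => [|m IH]; first by rewrite addn0 !subrr cnorm0.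
  rewrite addnS (le_trans (cnorm_split _ (u (n + m)%N) _)) //.
  have := step (n + m)%N; rewrite exprS; move: IH; lra.
have pos n : 0 < 2^-1 ^+ n :> R by rewrite exprn_gt0 // invr_gt0.
have le_tail n m : (n <= m)%N -> cnorm (u m - u n) <= 2 * 2^-1 ^+ n.
  move=> nm; have := tail n (m - n)%N; rewrite subnKC //; have := pos m; lra.
have [N NP] : exists N, 2^-1 ^+ N < e / 4.
  have e4 : 0 < e / 4 by rewrite divr_gt0.
  have [N] := ltr_add_invr e4; rewrite add0r => NP; exists N.+1.
  apply: le_lt_trans NP; rewrite exprVn lef_pV2 ?posrE ?exprn_gt0 //.
  by rewrite -natrX ler_nat ltnW // ltn_expl.
exists N => m n Nm Nn; have := cnorm_split (u m) (u N) (u n).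
have := le_tail _ _ Nm; have := le_tail _ _ Nn; rewrite cnormBC; lra.
Qed.

Lemma half_normc : Normc.normc (2^-1 : C) = 2^-1.
Proof.
by rewrite -(rmorph_nat (real_complex R) 2) -fmorphV normc_real ger0_norm ?invr_ge0.
Qed.

Lemma conj_half : (2^-1 : C)^*%C = 2^-1.
Proof. by rewrite conjc_inv conjc_nat. Qed.

(* Solves y = (h + y^2) / 2 by the contraction principle. *)
Lemma one_sub_square h : star h = h -> cnorm h <= 3 / 4 ->
  exists y, star y = y /\ 1 - h = (1 - y) * (1 - y).
Proof.
move=> hsa hle; pose F y := (2^-1 : C) *: (h + y * y).
pose u n := iter n F 0.
have usa n : star (u n) = u n.
  elim: n => [|n IH]; first exact: star0.
  by rewrite /= /F starZ starD starM hsa IH conj_half.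
(* Here 3/4 enters: (3/4 + 1/4) / 2 = 1/2, so the ball of radius 1/2 is invariant under [F]. On it
   [F] has Lipschitz constant 1/2. *)
have ule n : cnorm (u n) <= 2^-1.
  elim: n => [|n IH]; first by rewrite cnorm0 invr_ge0.
  rewrite /= /F cnormZ half_normc.
  have := cnormD h (u n * u n); have := cnormM (u n) (u n).
  have := cnorm_ge0 (u n); nra.
have diff y z : F y - F z = (2^-1 : C) *: (y * (y - z) + (y - z) * z).
  by rewrite /F -scalerBr mulrBr mulrBl addrA subrK opprD addrACA subrr add0r.
have Flip y z : cnorm (F y - F z) <= 2^-1 * (cnorm y + cnorm z) * cnorm (y - z).
  rewrite diff cnormZ half_normc -mulrA ler_pM2l ?invr_gt0 //.
  rewrite (le_trans (cnormD _ _)) // [leRHS]mulrDl lerD ?cnormM //.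
  by rewrite [leRHS]mulrC cnormM.
have [n|l lP] := @cauchy_geometric u.
  elim: n => [|n IH].
    by rewrite /= subr0 expr0 -[F 0]/(u 1%N) (le_trans (ule 1%N)) ?invf_le1 ?ler1n.
  rewrite /= exprS (le_trans (Flip _ _)) //.
  have := ule n.+1; have := ule n; have := cnorm_ge0 (F (u n) - u n).
  move: IH; rewrite /=; nra.
exists l; split.
  apply/eqP; rewrite -subr_eq0; apply/eqP/(@cnorm_small_eq0 _ 2) => e /lP[N NP].
  have := cnorm_split (star l) (u N) l.
  rewrite -{1}(usa N) -starB cnorm_starE (cnormBC l).
  have := NP N (leqnn N); lra.
have lE : l = F l.
  apply/eqP; rewrite -subr_eq0; apply/eqP.
  (* No bound on the norm of [l] has been derived, so the Lipschitz estimate between [u N] and [l]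
     leaves it in the constant. *)
  apply: (@cnorm_small_eq0 _ (2 + cnorm l)) => e /lP[N NP].
  have := cnorm_split l (u N.+1) (F l); rewrite (cnormBC l (u N.+1)).
  have := NP _ (leqnSn N); have := NP _ (leqnn N).
  have := Flip (u N) l; have := ule N.
  have := cnorm_ge0 (u N - l); have := cnorm_ge0 (u N); have := cnorm_ge0 l.
  rewrite -[u N.+1]/(F (u N)).
  move: (cnorm (u N - l)) (cnorm (F (u N) - l)) (cnorm (F (u N) - F l)).
  move: (cnorm (l - F l)) (cnorm (u N)) (cnorm l) => s v w p q r *.
  have : 2^-1 * (v + w) * p <= (1 + w) * e by nra.
  lra.
have l2 : l + l = h + l * l.
  rewrite -mulr2n -scaler_nat {1}lE /F scalerA divff ?scale1r //.
  by rewrite pnatr_eq0.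
rewrite mulrBr mulr1 mulrBl mul1r opprB.
have -> : l * l = l + l - h by rewrite l2 addrAC subrr add0r.
by rewrite [l + l - h - l]addrAC addrK addrA subrK.
Qed.

Variable phi : {scalar A}.
Hypothesis phi_ge0 : forall a : A, 0 <= phi (star a * a).

(** Polarisation: positivity at a + c b makes the sum of the two cross terms real; c = 1 settles the
    imaginary part and c = i the real part. *)
Lemma positive_hermitian a b : phi (star b * a) = (phi (star a * b))^*%C.
Proof.
have expand (c : C) : star (a + c *: b) * (a + c *: b) =
    star a * a + c *: (star a * b) + c^*%C *: (star b * a)
      + (c^*%C * c) *: (star b * b).
  by rewrite starD starZ mulrDl !mulrDr -!scalerAl -!scalerAr scalerA !addrA.
have real (c : C) : complex.Im (c * phi (star a * b) + c^*%C * phi (star b * a)) = 0.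
  have := ger0_Im (phi_ge0 (a + c *: b)); rewrite expand !linearD !linearZ /=.
  have ha := ger0_Im (phi_ge0 a); have hb := ger0_Im (phi_ge0 b).
  rewrite ha add0r => h; rewrite -[RHS]h -[LHS]addr0; congr (_ + _).
  rewrite (ge0_ReE (phi_ge0 b)); case: c {expand h} => p q /=.
  by rewrite mulr0; ring.
have r1 := real 1; have ri := real 'i%C.
move: r1 ri; case: (phi (star a * b)) => p q; case: (phi (star b * a)) => p' q' /=.
by move=> r1 ri; congr Complex; lra.
Qed.

Lemma positive_star a : phi (star a) = (phi a)^*%C.
Proof. by have := positive_hermitian 1 a; rewrite mulr1 star1 mul1r. Qed.

(** The difference of the two sides is the value of [phi] at the square of (1 - y) a, with y from
    [one_sub_square]. *)
Lemma positive_le_one h a : star h = h -> cnorm h <= 3 / 4 ->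
  phi (star a * h * a) <= phi (star a * a).
Proof.
move=> hsa hle; have [y [ysa yE]] := one_sub_square hsa hle.
rewrite -subr_ge0 -linearB /=.
have -> : star a * a - star a * h * a = star ((1 - y) * a) * ((1 - y) * a).
  rewrite starM starB star1 ysa -[RHS]mulrA -[X in _ - X]mulrA -mulrBr.
  by congr (_ * _); rewrite mulrA -yE mulrBl mul1r.
exact: phi_ge0.
Qed.

Lemma positive_bounded x : star x = x -> exists2 M : R, 0 <= M &
  forall a, phi (star (x * a) * (x * a)) <= M%:C%C * phi (star a * a).
Proof.
(* The factor 2 brings the norm of x^2 / M below 1/2, hence below 3/4; the summand 1 keeps [M]
   positive when [x] is 0. *)
move=> xsa; pose M : R := 2 * cnorm x ^+ 2 + 1.
have M0 : 0 < M by rewrite /M; have := sqr_ge0 (cnorm x); lra.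
exists M => [|a]; first exact: ltW.
have MC : 0 < M%:C%C :> C by rewrite (ltcR 0 M).
pose h := (M%:C%C)^-1 *: (x * x).
have hsa : star h = h by rewrite /h starZ starM xsa -fmorphV conjc_real.
have hle : cnorm h <= 3 / 4.
  rewrite /h cnormZ -fmorphV normc_real ger0_norm ?invr_ge0 ?(ltW M0) //.
  rewrite ler_pdivrMl // (le_trans (cnormM _ _)) // -expr2 /M.
  by have := sqr_ge0 (cnorm x); lra.
have := positive_le_one a hsa hle.
rewrite /h -scalerAr -scalerAl linearZ /= ler_pdivrMl //.
by rewrite starM xsa !mulrA.
Qed.

End CstarFacts.

(** * The weighted Fock space *)

Section PsdMore.
Variable R : realType.
Local Notation C := R[i].

Lemma psd_kernel_ext (I : Type) (K L : I -> I -> C) :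
  (forall u v, K u v = L u v) -> psd_kernel K -> psd_kernel L.
Proof.
move=> KL Kp n c u; have := Kp n c u; congr (0 <= _).
by apply: eq_bigr => i _; apply: eq_bigr => j _; rewrite KL.
Qed.

Lemma psd_kernel_mask (I : Type) (p : pred I) (K : I -> I -> C) :
  psd_kernel K -> psd_kernel (fun u v => if p u && p v then K u v else 0).
Proof.
move=> /(psd_kernel_weight (fun u => (p u)%:R)); apply: psd_kernel_ext => u v.
by rewrite conjc_nat -natrM mulnb; case: ifP; rewrite ?mul1r ?mul0r.
Qed.

End PsdMore.

Section Fock.
Variables (R : realType) (V : lmodType R[i]) (kappa : V -> V -> R[i]) (t : R).
Hypotheses (kappa_psd : psd_form kappa) (t_ge0 : 0 <= t).
Local Notation C := R[i].
Implicit Types (a b : V) (u v w : seq V).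

Definition by_nil (x y : C) u : C := if nilp u then x else y.

Lemma conj_by_nil (p q : R) u :
  (by_nil p%:C%C q%:C%C u)^*%C = by_nil p%:C%C q%:C%C u.
Proof. by rewrite /by_nil; case: ifP; rewrite conjc_real. Qed.

(* Weighting the factors after the first by t (rather than rescaling creation and
   annihilation by its square root) keeps the operators polynomial in t. *)
Definition wt u : C := by_nil 1 t%:C%C u.

(** On two words of equal length n >= 1 this is t^(n-1) times the product of the [kappa] values.
    Words stand for elementary tensors, and the multilinear relations hold only modulo null vectors
    of this form. *)
Fixpoint fock u v {struct u} : C :=
  match u, v with
  | [::], [::] => 1
  | a :: u', b :: v' => wt u' * (kappa a b * fock u' v')
  | _, _ => 0
  end.

Lemma fock_by_nil x y u v : by_nil x y u * fock u v = by_nil x y v * fock u v.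
Proof. by case: u v => [|a u] [|b v]; rewrite //= !mulr0. Qed.

Lemma fockC u v : fock u v = (fock v u)^*%C.
Proof.
elim: u v => [|a u IH] [|b v].
- exact/esym/conjc1.
- exact/esym/conjc0.
- exact/esym/conjc0.
rewrite [LHS]/= [fock (b :: v) _]/= mulrCA [wt u * _]fock_by_nil IH (psd_formC kappa_psd a b) !rmorphM.
by rewrite mulrCA; congr (_ * _); exact/esym/conj_by_nil.
Qed.

(** Without mixed terms the kernel is block diagonal for vacuum against nonempty words, so each
    block may be rescaled by its own constant. *)
Lemma psd_by_nil x y (K : seq V -> seq V -> C) : 0 <= x -> 0 <= y ->
  (forall u v, nilp u != nilp v -> K u v = 0) -> psd_kernel K ->
  psd_kernel (fun u v => by_nil x y u * K u v).
Proof.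
move=> x0 y0 Kmix Kp; apply: psd_kernel_ext (psd_kernelD
  (psd_kernelZ x0 (psd_kernel_mask (fun u => nilp u) Kp))
  (psd_kernelZ y0 (psd_kernel_mask (fun u => ~~ nilp u) Kp))) => u v.
rewrite /by_nil; have := Kmix u v.
case: (nilp u); case: (nilp v) => /= h; rewrite ?mulr0 ?addr0 ?add0r //;
by rewrite h // mulr0.
Qed.

Lemma psd_cons (f : V -> V -> C) (K : seq V -> seq V -> C) (x : C) :
  0 <= x -> psd_form f -> psd_kernel K ->
  psd_kernel (fun u v => match u, v with
    | [::], [::] => x
    | a :: u', b :: v' => f a b * K u' v'
    | _, _ => 0 end).
Proof.
move=> x0 fp Kp; apply: psd_kernel_ext (psd_kernelD
  (psd_kernelZ x0 (psd_kernel_mask (fun u => nilp u) (@psd_kernel1 R (seq V))))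
  (psd_kernel_mask (fun u => ~~ nilp u)
     (* The values that [head 0] and [behead] take on the empty word are defaults, removed by the
        mask. *)
     (psd_schur (head 0) fp (psd_kernel_comp behead Kp)))) => -[|a u] [|b v] /=;
by rewrite ?mulr1 ?mulr0 ?addr0 ?add0r.
Qed.

(* Truncation in the tensor degree makes positivity an induction on kernels. *)
Fixpoint fock_trunc n u v : C :=
  if n is n'.+1 then
    match u, v with
    | [::], [::] => 1
    | a :: u', b :: v' => kappa a b * (wt u' * fock_trunc n' u' v')
    | _, _ => 0
    end
  else 0.

Lemma fock_trunc_psd n : psd_kernel (fock_trunc n).
Proof.
elim: n => [|n IH].
  by move=> n c u; rewrite big1 // => i _; rewrite big1 // => j _; rewrite mulr0.
apply: psd_cons => //; apply: psd_by_nil => //; first by rewrite ler0c.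
by case: n {IH} => [|n] [|a u] [|b v].
Qed.

Lemma fock_truncE n u v : (size u < n)%N -> fock u v = fock_trunc n u v.
Proof.
elim: n u v => [//|n IH] [|a u] [|b v] //= un.
by rewrite (IH u v) // mulrCA.
Qed.

Lemma fock_psd : psd_kernel fock.
Proof.
move=> n c u; have := @fock_trunc_psd (\max_i size (u i)).+1 n c u.
congr (0 <= _); apply: eq_bigr => i _; apply: eq_bigr => j _.
by rewrite (@fock_truncE (\max_i size (u i)).+1) // ltnS (leq_bigmax i).
Qed.

Lemma fock_mix u v : nilp u != nilp v -> fock u v = 0.
Proof. by case: u v => [|a u] [|b v]. Qed.

Definition fock_kernel : kernelSpace R :=
  @KernelSpace R (seq V) fock [::] fock_psd fockC erefl.

Definition fock_space := kernel_preHilbert fock_kernel.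
Local Notation bra_ket := (@ip _ fock_space).
Local Notation ketF := (@ket R fock_kernel).

Lemma ip_ketF u v : bra_ket (ketF u) (ketF v) = fock u v.
Proof. exact: ip_ket. Qed.

Local Arguments ip : simpl never.
Local Arguments ket : simpl never.

Section Creation.
Variable b : V.

Definition creation_ket u : fock_space := ketF (b :: u).
(** The factor [wt u'] is the weight that the removed factor contributed to the form; the adjoint
    relation forces it. *)
Definition annihilation_ket u : fock_space :=
  if u is a :: u' then (wt u' * kappa b a) *: ketF u' else 0.

Let bb := complex.Re (kappa b b).
Let bb_ge0 : 0 <= (1 + t) * bb.
Proof. by rewrite mulr_ge0 ?addr_ge0 // Re_ge0 // (psd_form_ge0 kappa_psd). Qed.

Lemma creation_adj u v :
  bra_ket (creation_ket u) (ketF v) = bra_ket (ketF u) (annihilation_ket v).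
Proof.
rewrite ip_ketF; case: v => [|a v] /=; first by rewrite ip0r.
by rewrite ipZr ip_ketF mulrCA [wt u * _]fock_by_nil mulrCA mulrA.
Qed.

(** Creating [b] multiplies the form by [kappa b b] and by the weight 1 on the vacuum or t
    elsewhere; 1 + t dominates both, and the defect carries the remaining factors t and 1. *)
Lemma creation_bounded : psd_kernel (fun u v =>
  ((1 + t) * bb)%:C%C * fock u v - bra_ket (creation_ket u) (creation_ket v)).
Proof.
have bbE : kappa b b = bb%:C%C by rewrite /bb -ge0_ReE // (psd_form_ge0 kappa_psd).
apply: psd_kernel_ext (psd_kernelZ (_ : 0 <= bb%:C%C)
  (psd_by_nil (_ : 0 <= t%:C%C) (_ : 0 <= 1) fock_mix fock_psd)).
- move=> u v; rewrite ip_ketF /= bbE rmorphM rmorphD rmorph1 /wt /by_nil.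
  by case: ifP => _; ring.
- by rewrite ler0c /bb Re_ge0 // (psd_form_ge0 kappa_psd).
- by rewrite ler0c.
- by [].
Qed.

Definition creation : boundedOp fock_space :=
  kernel_op (S := fock_kernel) bb_ge0 creation_adj creation_bounded.

Lemma creation_ketE u : creation (ketF u) = ketF (b :: u).
Proof. exact: malg_lin_ket. Qed.

Lemma annihilation_ketE u : op_star creation (ketF u) = annihilation_ket u.
Proof. exact: malg_lin_ket. Qed.

End Creation.

Section Preservation.
Variables (T : V -> V) (M : R).
Hypotheses (T_linear : linear T) (T_sym : forall a b, kappa (T a) b = kappa a (T b)).
Hypotheses (M_ge0 : 0 <= M) (T_le : forall a, kappa (T a) (T a) <= M%:C%C * kappa a a).

Definition preservation_ket u : fock_space :=
  if u is a :: u' then ketF (T a :: u') else 0.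

Lemma preservation_adj u v : bra_ket (preservation_ket u) (ketF v) =
  bra_ket (ketF u) (preservation_ket v).
Proof.
case: u v => [|a u] [|b v] /=; rewrite ?ip0l ?ip0r ?ip_ketF //=.
by rewrite T_sym.
Qed.

(** The one-factor form of M minus the square of T. Tensored with the remaining factors by
    [psd_cons], it gives the bound on the whole space. *)
Lemma defect_psd : psd_form (fun a b => M%:C%C * kappa a b - kappa (T a) (T b)).
Proof.
split=> [a c b b'|a b|a].
- rewrite T_linear !(psd_form_linear kappa_psd); ring.
- rewrite (psd_formC kappa_psd a b) (psd_formC kappa_psd (T a)).
  by rewrite -{1}(conjc_real M) -rmorphM -rmorphB.
- by rewrite subr_ge0.
Qed.

Lemma preservation_bounded : psd_kernel (fun u v =>
  M%:C%C * fock u v - bra_ket (preservation_ket u) (preservation_ket v)).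
Proof.
apply: psd_kernel_ext (psd_cons (_ : 0 <= M%:C%C) defect_psd
  (psd_by_nil (_ : 0 <= 1) (_ : 0 <= t%:C%C) fock_mix fock_psd)).
- move=> [|a u] [|b v]; rewrite /= ?ip0l ?ip0r ?ip_ketF /= ?mulr0 ?mulr1 ?subr0 //.
  by rewrite /wt; ring.
- by rewrite ler0c.
- by [].
- by rewrite ler0c.
Qed.

Definition preservation : boundedOp fock_space :=
  kernel_op (S := fock_kernel) M_ge0 preservation_adj preservation_bounded.

Lemma preservation_sa : op_star preservation = preservation.
Proof. exact: op_ext. Qed.

Lemma preservation_ketE u : preservation (ketF u) = preservation_ket u.
Proof. exact: malg_lin_ket. Qed.

End Preservation.

Section Diagonal.
Variables (p q : R).

Definition diagonal_ket u : fock_space := by_nil p%:C%C q%:C%C u *: ketF u.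

Lemma diagonal_adj u v :
  bra_ket (diagonal_ket u) (ketF v) = bra_ket (ketF u) (diagonal_ket v).
Proof. by rewrite ipZl ipZr !ip_ketF conj_by_nil fock_by_nil. Qed.

Let pq_ge0 : 0 <= p ^+ 2 + q ^+ 2. Proof. by rewrite addr_ge0 ?sqr_ge0. Qed.

Lemma diagonal_bounded : psd_kernel (fun u v =>
  (p ^+ 2 + q ^+ 2)%:C%C * fock u v - bra_ket (diagonal_ket u) (diagonal_ket v)).
Proof.
apply: psd_kernel_ext (psd_by_nil (_ : 0 <= (q ^+ 2)%:C%C)
  (_ : 0 <= (p ^+ 2)%:C%C) fock_mix fock_psd).
- move=> u v; rewrite ipZl ipZr ip_ketF conj_by_nil -fock_by_nil rmorphD !rmorphXn.
  by rewrite /by_nil; case: ifP => _; ring.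
- by rewrite ler0c sqr_ge0.
- by rewrite ler0c sqr_ge0.
Qed.

Definition diagonal_op : boundedOp fock_space :=
  kernel_op (S := fock_kernel) pq_ge0 diagonal_adj diagonal_bounded.

Lemma diagonal_sa : op_star diagonal_op = diagonal_op.
Proof. exact: op_ext. Qed.

Lemma diagonal_ketE u : diagonal_op (ketF u) = diagonal_ket u.
Proof. exact: malg_lin_ket. Qed.

End Diagonal.
End Fock.

(** * First-passage recursion for the vacuum moments *)

Section FockModel.
Variables (R : realType) (V : lmodType R[i]) (kappa : V -> V -> R[i]) (t : R).
Hypotheses (kappa_psd : psd_form kappa) (t_ge0 : 0 <= t).
Variables (k : nat) (v : 'I_k -> V) (T : 'I_k -> V -> V) (a M : 'I_k -> R).
Hypotheses (T_linear : forall j, linear (T j)).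
Hypotheses (T_sym : forall j b c, kappa (T j b) c = kappa b (T j c)).
Hypotheses (M_ge0 : forall j, 0 <= M j).
Hypotheses (T_le : forall j b, kappa (T j b) (T j b) <= (M j)%:C%C * kappa b b).
Local Notation C := R[i].
Local Notation series := (ncseries C k).
Local Notation F := (fock_space kappa_psd t_ge0).
Local Notation ketF := (@ket R (fock_kernel kappa_psd t_ge0)).
Implicit Types (u : seq V) (w : seq 'I_k).

Definition fock_op (j : 'I_k) : boundedOp F :=
  creation kappa_psd t_ge0 (v j) + op_star (creation kappa_psd t_ge0 (v j)) +
  preservation kappa_psd t_ge0 (T_linear j) (T_sym j) (M_ge0 j) (T_le j) +
  diagonal_op kappa_psd t_ge0 (a j) (t * a j).

Lemma fock_op_sa j : op_star (fock_op j) = fock_op j.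
Proof.
rewrite /fock_op !op_starD op_starK preservation_sa diagonal_sa.
by rewrite [X in X + _ + _ = _]addrC.
Qed.

Lemma fock_op_ketE j u : fock_op j (ketF u) =
  ketF (v j :: u) + annihilation_ket kappa_psd t_ge0 (v j) u +
  preservation_ket kappa_psd t_ge0 (T j) u +
  diagonal_ket kappa_psd t_ge0 (a j) (t * a j) u.
Proof.
rewrite -[LHS]/(_ (ketF u) + _ (ketF u) + _ (ketF u) + _ (ketF u)).
by rewrite creation_ketE annihilation_ketE preservation_ketE diagonal_ketE.
Qed.

Definition fock_coef u w : C :=
  ip (ketF u) (foldr (fun j => fock_op j) (ph_vac F) w).

(** The first letter of the word acts last, so selfadjointness moves it onto [u]; amplitudes thus
    obey a recursion that strips first letters, like [nctail] does. *)
Lemma fock_coef_cons u j w : fock_coef u (j :: w) =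
  ip (fock_op j (ketF u) : F) (foldr (fun j => fock_op j) (ph_vac F) w).
Proof. by rewrite -{1}[fock_op j]fock_op_sa op_adj. Qed.

Lemma fock_coef_nil u : fock_coef u [::] = (nilp u)%:R.
Proof. by rewrite /fock_coef ip_ketF; case: u. Qed.

(** [g b] counts the ways to get rid of the leading factor [b] for the first time. In [g_tail] the
    first step annihilates [b], changes it by [T j], multiplies by a scalar, or creates [v j], which
    must go before [b] can. [N] is the first-return series of the vacuum. *)
Variables (g : V -> series) (N : series).
Hypothesis g_nil : forall b, g b [::] = 0.
Hypothesis g_tail : forall b j, nctail (g b) j =
  kappa b (v j) *: 1 + g (T j b) + (t * a j)%:C%C *: g b
    + t%:C%C *: (g (v j) * g b).
Hypothesis N_nil : N [::] = 0.
Hypothesis N_tail : forall j, nctail N j = (a j)%:C%C *: 1 + g (v j).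

(** Factors disappear from the left one after another, so the amplitude from a word to the vacuum
    factorises, ending with the full return series (1 - N)^-1. *)
Fixpoint fock_series u : series :=
  if u is b :: u' then wt t u' *: (g b * fock_series u') else (1 - N)^-1.

Let vac_eq : (1 - N)^-1 = 1 + N * (1 - N)^-1.
Proof. by have := resolventE 1 N_nil; rewrite !scale1r. Qed.

Lemma fock_series_nil u : fock_series u [::] = (nilp u)%:R.
Proof.
case: u => [|b u] /=; first by rewrite vac_eq ncaddE ncmul0 N_nil mul0r addr0.
by rewrite ncscaleE ncmul0 g_nil mul0r mulr0.
Qed.

Lemma fock_seriesE u w : fock_coef u w = fock_series u w.
Proof.
elim: w u => [|j w IH] u; first by rewrite fock_coef_nil fock_series_nil.
rewrite fock_coef_cons fock_op_ketE !ipDl.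
have coefE u' : ip (ketF u') (foldr (fun j => fock_op j) (ph_vac F) w) =
  fock_series u' w by exact: IH.
rewrite -[RHS]/(nctail (fock_series u) j w).
case: u => [|b u].
  rewrite /annihilation_ket /preservation_ket /diagonal_ket /by_nil !ip0l !addr0.
  rewrite ipZl !coefE conjc_real /=.
  rewrite [in RHS]vac_eq nctailD nctail1 add0r nctailM N_nil scale0r add0r.
  rewrite N_tail mulrDl -scalerAl mul1r ncaddE [X in _ = X + _]ncscaleE addrC.
  have -> : wt t ([::] : seq V) = 1 by [].
  by rewrite scale1r.
rewrite /annihilation_ket /preservation_ket.
rewrite -[diagonal_ket _ _ _ _ _]/((t * a j)%:C%C *: ketF (b :: u)).
have conjE : conjc (wt t u * kappa (v j) b) = wt t u * kappa b (v j).
  rewrite rmorphM; congr (_ * _); first exact: (conj_by_nil 1 t u).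
  exact/esym/(psd_formC kappa_psd).
rewrite !ipZl !coefE conjc_real conjE.
rewrite [fock_series (b :: u)]/= nctailZ nctailM g_nil scale0r add0r g_tail.
rewrite !mulrDl -!scalerAl mul1r !scalerDr.
(* A factor created in front of a nonempty word has weight t, which is the coefficient of the
   quadratic term in [g_tail]. *)
rewrite -[fock_series [:: _, _ & _]]/(t%:C%C *: (g (v j) * (wt t u *: (g b * fock_series u)))).
rewrite -[fock_series (T j b :: u)]/(wt t u *: (g (T j b) * fock_series u)).
rewrite -!scalerAr -?mulrA !(ncaddE, ncscaleE).
have scaleE (x y : C) : x *: (y : C^o) = x * y by [].
rewrite ?scaleE; ring.
Qed.

Lemma fock_moment w :
  ip (ph_vac F) (foldr (fun j => fock_op j) (ph_vac F) w) = (1 - N)^-1 w.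
Proof. exact: (fock_seriesE [::] w). Qed.

End FockModel.

(** * The Fock model of [BB t mu] *)

Section BBModel.
Variables (R : realType) (k : nat) (A : cstarAlgType R) (phi : {scalar A}).
Variables (x : 'I_k -> A) (mu : dalg R k).
Local Notation C := R[i].
Local Notation series := (ncseries C k).
Hypothesis phi1 : phi 1 = 1.
Hypothesis phi_ge0 : forall a : A, 0 <= phi (star a * a).
Hypothesis xsa : forall i, star (x i) = x i.
Hypothesis joint : joint_distribution phi x mu.
Implicit Types (b c : A) (w : seq 'I_k).

Let phiB b c : phi (b - c) = phi b - phi c. Proof. exact: linearB. Qed.
Let phiZ (a : C) b : phi (a *: b) = a * phi b. Proof. exact: linearZ. Qed.

(** The inner product of the centred elements, taken on all of [A]: multiples of the unit become
    null vectors, so no subspace has to be formed. *)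
Definition covariance b c : C := phi (star b * c) - (phi b)^*%C * phi c.

Definition centered b : A := b - phi b *: 1.

Lemma covarianceE b c : covariance b c = phi (star (centered b) * c).
Proof.
rewrite /covariance /centered starB starZ star1 mulrBl -scalerAl mul1r.
by rewrite phiB phiZ.
Qed.

Lemma covariance_centered b c : covariance b (centered c) = covariance b c.
Proof.
rewrite /covariance /centered mulrBr -scalerAr mulr1 !phiB !phiZ phi1.
by rewrite (positive_star phi_ge0); ring.
Qed.

Lemma covariance_psd : psd_form covariance.
Proof.
split=> [b a c d|b c|b].
- by rewrite !covarianceE mulrDr -scalerAr linearP.
- rewrite -covariance_centered covarianceE (positive_hermitian phi_ge0).
  by rewrite -covarianceE covariance_centered.
- by rewrite -covariance_centered covarianceE.
Qed.

(** [x j] applied to the centred [b] ([shiftE]). Projecting the result back would change it only by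
    a multiple of the unit, which [covariance] does not see. *)
Definition shift (j : 'I_k) b : A := x j * b - phi b *: x j.

Lemma shiftE j b : shift j b = x j * centered b.
Proof. by rewrite /shift /centered mulrBr -scalerAr mulr1. Qed.

Lemma shift_linear j : linear (shift j).
Proof.
move=> a b c; rewrite /shift mulrDr -scalerAr linearP /= scalerDl scalerBr.
by rewrite scalerA opprD addrACA.
Qed.

Lemma shift_sym j b c : covariance (shift j b) c = covariance b (shift j c).
Proof.
rewrite [RHS]covarianceE -covariance_centered shiftE /covariance.
have := positive_star phi_ge0 (x j * centered b).
rewrite starM xsa => <-; rewrite shiftE -!mulrA.
rewrite {1}/centered !mulrBr -!scalerAr mulr1 phiB phiZ.
have c0 : phi (centered c) = 0.
  by rewrite /centered phiB phiZ phi1 mulr1 subrr.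
by rewrite c0 mulr0 subr0.
Qed.

(** Dropping the subtracted square on the left leaves [phi] of a square, to which [positive_bounded]
    applies at the centred [b]. *)
Lemma shift_bounded j : exists2 M : R, 0 <= M &
  forall b, covariance (shift j b) (shift j b) <= M%:C%C * covariance b b.
Proof.
have [M M0 MP] := positive_bounded phi_ge0 (xsa j); exists M => // b.
rewrite -[covariance b b]covariance_centered [in leRHS]covarianceE.
apply: le_trans (MP _); rewrite /covariance shiftE lerBlDr lerDl mulrC.
exact: mulcJ_ge0.
Qed.

Lemma moment_real j : phi (x j) = (complex.Re (phi (x j)))%:C%C.
Proof.
have := positive_star phi_ge0 (x j); rewrite xsa.
by case: (phi (x j)) => p q [] q0; rewrite (_ : q = 0) //=; lra.
Qed.

Definition word_series b : series := fun w => phi (star b * \prod_(i <- w) x i).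

Lemma word_series_tail b j : nctail (word_series b) j = word_series (x j * b).
Proof.
by apply: funext => w; rewrite /nctail /word_series big_cons mulrA starM xsa.
Qed.

Lemma word_series_nil b : word_series b [::] = phi (star b).
Proof. by rewrite /word_series big_nil mulr1. Qed.

Lemma word_series_lin b c (a : C) :
  word_series (b - a *: c) = word_series b - a^*%C *: word_series c.
Proof.
apply: funext => w; rewrite ncaddE ncoppE ncscaleE /word_series.
by rewrite starB starZ mulrBl -scalerAl phiB phiZ.
Qed.

Lemma word_series1 : word_series 1 = 1 + moment_series mu.
Proof.
apply: funext => w; by rewrite moment_series1D joint /word_series star1 mul1r.
Qed.

Let eta : series := eta_series mu.
Let eta0 : eta [::] = 0. Proof. exact: eta_series_nil. Qed.

(* Up to (1 - eta), the moments of b with the words in x; it satisfies the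
   first-passage recursion [compressed_tail] of the x_j compressed to the
   orthocomplement of the unit. *)
Definition compressed b : series := word_series b * (1 - eta) - phi (star b) *: 1.

Lemma compressed_lin b c (a : C) :
  compressed (b - a *: c) = compressed b - a^*%C *: compressed c.
Proof.
rewrite /compressed word_series_lin starB starZ phiB phiZ mulrBl.
by rewrite -scalerAl scalerBl scalerBr scalerA !opprD !opprK addrACA.
Qed.

(** [word_series 1] is 1 + M_mu, the inverse of 1 - eta. *)
Lemma compressed1 : compressed 1 = 0.
Proof.
rewrite /compressed word_series1 star1 phi1 scale1r /eta eta_seriesE.
by rewrite mulrV ?subrr // unit_1D.
Qed.

Lemma compressed_nil b : compressed b [::] = 0.
Proof.
rewrite /compressed ncaddE ncoppE ncscaleE ncmul0 word_series_nil ncaddE ncoppE.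
by rewrite /eta eta_series_nil nconeE subr0 subrr.
Qed.

Lemma compressed_tail_eta b j : nctail (compressed b) j =
  compressed (x j * b) + phi (star b * x j) *: 1 - phi (star b) *: nctail eta j.
Proof.
rewrite {1}/compressed nctailD -scaleNr nctailZ nctail1 scaler0 addr0.
rewrite nctailM word_series_tail word_series_nil nctailD nctail1 add0r.
rewrite -[nctail (- eta) j]/(- nctail eta j) scalerN.
by rewrite /compressed starM xsa subrK addrC.
Qed.

(** The case b = 1 of [compressed_tail_eta], whose left side vanishes by [compressed1]. *)
Lemma eta_tail j : nctail eta j = phi (x j) *: 1 + compressed (x j).
Proof.
have := compressed_tail_eta 1 j; rewrite compressed1 nctail0 star1 phi1 scale1r.
rewrite mulr1 mul1r => /esym/eqP; rewrite subr_eq0 => /eqP <-.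
by rewrite addrC.
Qed.

Lemma compressed_tail b j : nctail (compressed b) j =
  covariance b (x j) *: 1 + compressed (shift j b).
Proof.
rewrite compressed_tail_eta eta_tail /shift compressed_lin /covariance.
rewrite (positive_star phi_ge0) scalerBl scalerDr scalerA opprD.
by rewrite [RHS]addrACA [compressed _ + _]addrC.
Qed.

Variables (t : R) (nu : dalg R k).
Hypothesis t_ge0 : 0 <= t.
Hypothesis nu_evol : evol t%:C%C eta (eta_series nu).

Let N : series := eta_series nu.
Let N0 : N [::] = 0. Proof. exact: eta_series_nil. Qed.
Let G : series := (1 - t%:C%C *: N)^-1.

Let G_unit : G \is a GRing.unit.
Proof. by rewrite unitrV unit_1B // eta_series_nil. Qed.

Let NE : N = zsubst G eta * G^-1.
Proof. by have [_ <-] := nu_evol; rewrite mulrK. Qed.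

(** Substitution puts an excursion [G] after every letter; conjugation by [G] moves it in front of
    every letter. By contrast [N], by [NE], carries excursions only between letters. *)
Definition nested b : series := G * zsubst G (compressed b) * G^-1.

Lemma nested_nil b : nested b [::] = 0.
Proof. by rewrite /nested !ncmul0 zsubst_nil compressed_nil mulr0 mul0r. Qed.

Lemma nested_N_tail j :
  nctail N j = (complex.Re (phi (x j)))%:C%C *: 1 + nested (x j).
Proof.
rewrite NE nctailM zsubst_nil eta0 scale0r add0r nctail_zsubst eta_tail.
rewrite linearD linearZ /= rmorph1 mulrDr mulrDl -scalerAr mulr1 -scalerAl.
by rewrite mulrV // -moment_real.
Qed.

(** The first letter comes either from [compressed b] or from the leading [G]. The latter has tail t
    [nctail N j] G, and [nested_N_tail] splits this into the scalar term and the quadratic one. *)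
Lemma nested_tail b j : nctail (nested b) j =
  covariance b (x j) *: 1 + nested (shift j b)
    + (t * complex.Re (phi (x j)))%:C%C *: nested b
    + t%:C%C *: (nested (x j) * nested b).
Proof.
have G0 : G [::] = 1.
  have : (G * (1 - t%:C%C *: N)) [::] = (1 : series) [::].
    by rewrite mulVr // unit_1B.
  by rewrite ncmul0 ncaddE ncoppE ncscaleE N0 mulr0 subr0 mulr1.
have Gtail : nctail G j = t%:C%C *: (nctail N j * G).
  rewrite {1}/G (resolventE _ N0) nctailD nctail1 add0r nctailZ.
  by rewrite nctailM N0 scale0r add0r.
rewrite {1}/nested -mulrA nctailM G0 scale1r nctailM zsubst_nil compressed_nil.
rewrite scale0r add0r nctail_zsubst Gtail nested_N_tail compressed_tail.
rewrite linearD linearZ /= rmorph1 mulrDr mulrDl -scalerAr mulr1 -scalerAl mulrV //.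
have GB : G * (zsubst G (compressed b) / G) = nested b by rewrite mulrA.
rewrite -[RHS]addrA; congr (_ + _); rewrite -scalerAl -mulrA GB.
by rewrite mulrDl -scalerAl mul1r scalerDr scalerA -rmorphM.
Qed.

(** [nested] and [N] satisfy the recursions required of [g] and [N] in the Fock model, with [shift]
    as preservation part and [x] as created vectors, so the vacuum moments there are those of
    [nu]. *)
Lemma BB_in_Dc : Dc nu.
Proof.
have /choice[M MP] j : exists M : R, 0 <= M /\
    forall b, covariance (shift j b) (shift j b) <= M%:C%C * covariance b b.
  by have [M M0 MP] := shift_bounded j; exists M.
pose Y := @fock_op R A covariance t covariance_psd t_ge0 k x shift
  (fun j => complex.Re (phi (x j))) M shift_linear shift_sym
  (fun j => (MP j).1) (fun j => (MP j).2).
have Ysa j : op_star (Y j) = Y j by exact: fock_op_sa.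
have [B [psi [y [psi1 psi_ge0 ysa yE]]]] := preHilbert_realization Ysa.
exists B, psi, y; split=> // w; rewrite yE.
have -> : ip (ph_vac _) (foldr (fun j => Y j) (ph_vac _) w) = (1 - N)^-1 w.
  by apply: fock_moment nested_nil nested_tail N0 nested_N_tail _.
by rewrite -moment_seriesE moment_series1D.
Qed.

End BBModel.

(** Membership in [Dc] is delivered together with the equation, so the construction can be restarted
    from [nu] in the semigroup law. *)
Lemma Dc_evol (R : realType) (k : nat) (mu : dalg R k) (t : R) :
  Dc mu -> 0 <= t ->
  exists2 nu, Dc nu & evol t%:C%C (eta_series mu) (eta_series nu).
Proof.
move=> [A [phi [x [phi1 phi_ge0 xsa joint]]]] t0.
have [N NE] := evol_exists t%:C%C (eta_series_nil mu).
have [nu nuE] := eta_series_onto NE.1; rewrite -nuE in NE.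
by exists nu => //; apply: (BB_in_Dc phi1 phi_ge0 xsa joint t0 NE).
Qed.

Theorem corollary7p3 (R : realType) (k : nat) (hk : (1 <= k)%N) :
  (forall t : R, 0 <= t ->
     forall mu : dalg R k, Dc mu -> Dc (BB t mu)) /\
  (forall s t : R, 0 <= s -> 0 <= t ->
     forall mu : dalg R k, Dc mu -> BB s (BB t mu) = BB (s + t) mu) /\
  (forall mu : dalg R k, Dc mu -> BB 1 mu = boolean_BP mu).
Proof.
split=> [t t0 mu /Dc_evol/(_ t0)[nu nuDc /(BB_eq t0)->] //|].
split=> [s t s0 t0 mu|mu] /Dc_evol.
  move=> /(_ _ t0)[nu /Dc_evol/(_ s0)[nu' _ evol_s] evol_t].
  rewrite (BB_eq t0 evol_t) (BB_eq s0 evol_s); apply/esym/BB_eq.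
    exact: addr_ge0.
  by rewrite rmorphD; exact: evol_comp evol_t evol_s.
move=> /(_ _ ler01)[nu _ evol_1].
by rewrite (BB_eq ler01 evol_1); apply/esym/boolean_BP_eq; exact: evol_1.
Qed.
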